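(* Let $F$ be a field of characteristic $2$ and let $K/F$ be a field extension such that $K^2\subset F$. Then: (i) The extension $K/F$ is excellent for quadratic forms. (ii) $$W_q(K/F)=\sum_{t\in K^{*2}}\langle 1,t\rangle_b\otimes W_q(F).$$
   Context: All fields have characteristic $2$; all forms are on finite-dimensional vector spaces (dimension $0$ allowed); bilinear forms are symmetric and nonsingular. Quadratic forms. For a quadratic form $q$ on an $F$-vector space $V$ let $B_q(x,y)=q(x+y)+q(x)+q(y)$ and $\operatorname{rad}(q)=\{x\in V : B_q(x,V)=0\}$; $q$ is nonsingular if $\operatorname{rad}(q)=0$ and totally singular if $\operatorname{rad}(q)=V$. $[a,b]$ denotes the form $ax^2+xy+by^2$, $\langle a_1,\dots,a_n\rangle$ the totally singular form $a_1x_1^2+\dots+a_nx_n^2$, and $\mathbb H=[0,0]$ the hyperbolic plane. Every quadratic form decomposes as $q\cong k\times\mathbb H\perp q_{\mathrm{an}}\perp\langle 0,\dots,0\rangle$ with $q_{\mathrm{an}}$ anisotropic (no nonzero vector $x$ with $q(x)=0$); $q_{\mathrm{an}}$ is unique up to isometry and is called the anisotropic part of $q$. Two quadratic forms are Witt equivalent, $q\sim q'$, if $q_{\mathrm{an}}\cong q'_{\mathrm{an}}$. $W_q(F)$ is the Witt group of Witt equivalence classes of nonsingular quadratic forms over $F$, with addition induced by $\perp$. It is a module over the Witt ring $W(F)$ of nonsingular symmetric bilinear forms, where $\langle a_1,\dots,a_n\rangle_b$ denotes the diagonal bilinear form with entries $a_i\in F^*$ and $\langle a_1,\dots,a_n\rangle_b\otimes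 q= a_1q\perp\dots\perp a_nq$. For a field extension $K/F$, $q_K$ is the scalar extension of $q$ to $K$, and $W_q(K/F)$ is the kernel of the natural map $W_q(F)\to W_q(K)$. $K/F$ is excellent for quadratic forms if for every quadratic form $q$ over $F$ (possibly singular) there is a quadratic form $\varphi$ over $F$ with $(q_K)_{\mathrm{an}}\cong\varphi_K$. $K^2=\{x^2: x\in K\}$ and $K^{*2}=\{x^2: x\in K^*\}$. $\sum_t \langle 1,t\rangle_b\otimes W_q(F)$ is the sum of subgroups of $W_q(F)$. *)

(* Defs.v *)
From HB Require Import structures.
From mathcomp Require Import all_boot all_order all_algebra ring.
From mathcomp Require Import boolp classical_sets.

Set Implicit Arguments.
Unset Strict Implicit.
Unset Printing Implicit Defensive.

Import GRing.Theory.
Local Open Scope ring_scope.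
Local Open Scope classical_set_scope.

(* The polar form of q. In characteristic 2 this is q(x+y) + q(x) + q(y). *)
Definition polar (F : fieldType) (V : lmodType F) (q : V -> F) (x y : V) : F :=
  q (x + y) - q x - q y.

(* Since the polar form is symmetric, linearity in one variable is enough for
   it to be bilinear. *)
Definition is_quadratic (F : fieldType) (V : lmodType F) (q : V -> F) : Prop :=
  (forall (a : F) (x : V), q (a *: x) = a ^+ 2 * q x) /\
  (forall x : V, scalar (polar q x)).

(* A finite-dimensional vector space is given in coordinates, as F^n, n >= 0. *)
Record qform (F : fieldType) := QForm {
  qdim : nat;
  qval :> 'rV[F]_qdim -> F;
  qvalP : is_quadratic qval
}.

Section Forms.
Variable F : fieldType.
Implicit Types q : qform F.

Definition nonsingular q : Prop :=
  forall x, (forall y, polar q x y = 0) -> x = 0.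

Definition anisotropic q : Prop := forall x, q x = 0 -> x = 0.

Definition isometric q q' : Prop :=
  exists f : {linear 'rV[F]_(qdim q) -> 'rV[F]_(qdim q')},
    bijective f /\ forall x, q' (f x) = q x.

Lemma zero_is_quadratic n : is_quadratic (fun _ : 'rV[F]_n => 0).
Proof.
by split=> [a x|x a y z]; rewrite /polar ?mulr0 // !subr0 mulr0 addr0.
Qed.

(* <0, ..., 0> of dimension n *)
Definition qzero n : qform F := QForm (@zero_is_quadratic n).

Lemma binary_is_quadratic (a b : F) : is_quadratic (fun x : 'rV[F]_2 =>
  a * x 0 0 ^+ 2 + x 0 0 * x 0 1 + b * x 0 1 ^+ 2).
Proof. by split=> [c x|x c y z]; rewrite /polar !mxE; ring. Qed.

(* [a, b] *)
Definition qbinary (a b : F) : qform F := QForm (binary_is_quadratic a b).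

Definition hyperbolic_plane : qform F := qbinary 0 0.

Lemma scale_is_quadratic (a : F) q : is_quadratic (fun x => a * q x).
Proof.
have [qZ qB] := qvalP q; split=> [c x|x c y z]; first by rewrite qZ mulrCA.
by rewrite /polar -!mulrBr -![q _ - _ - _]/(polar q _ _) qB mulrDr mulrCA.
Qed.

Definition qscale (a : F) q : qform F := QForm (scale_is_quadratic a q).

Lemma perp_is_quadratic q q' :
  is_quadratic (fun x : 'rV[F]_(qdim q + qdim q') => q (lsubmx x) + q' (rsubmx x)).
Proof.
have [qZ qB] := qvalP q; have [qZ' qB'] := qvalP q'.
have E x y : polar (fun x : 'rV[F]_(qdim q + qdim q') =>
    q (lsubmx x) + q' (rsubmx x)) x y
  = polar q (lsubmx x) (lsubmx y) + polar q' (rsubmx x) (rsubmx y).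
  by rewrite /polar !linearD /=; ring.
split=> [c x|x c y z]; first by rewrite !linearZ /= qZ qZ' mulrDr.
by rewrite !E !linearP /= qB qB'; ring.
Qed.

Definition perp q q' : qform F := QForm (perp_is_quadratic q q').

(* k x q *)
Definition qcopies (k : nat) q : qform F := iter k (perp q) (qzero 0).

(* <a_1, ..., a_n>_b \otimes q *)
Definition diag_tensor (s : seq F) q : qform F :=
  \big[perp/qzero 0]_(a <- s) qscale a q.

(* p is "the" anisotropic part of q (it is unique up to isometry) *)
Definition anisotropic_part q p : Prop :=
  anisotropic p /\
  exists k m : nat,
    isometric q (perp (qcopies k hyperbolic_plane) (perp p (qzero m))).

Definition witt_equiv q q' : Prop :=
  exists p p' : qform F,
    [/\ anisotropic_part q p, anisotropic_part q' p' & isometric p p'].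

(* An element of W_q(F) is an equivalence class, that is, a set of forms. *)
Definition witt_class q : set (qform F) :=
  [set q' | nonsingular q' /\ witt_equiv q' q].

Definition Wq : set (set (qform F)) := [set witt_class q | q in nonsingular].

Definition witt0 : set (qform F) := witt_class (qzero 0).

(* The operations on classes are defined by taking all representatives; on
   elements of W_q(F), the union is that of copies of a single class. *)
Definition witt_add (C D : set (qform F)) : set (qform F) :=
  \bigcup_(q in C) \bigcup_(q' in D) witt_class (perp q q').

(* <a_1, ..., a_n>_b \otimes C *)
Definition witt_diag (s : seq F) (C : set (qform F)) : set (qform F) :=
  \bigcup_(q in C) witt_class (diag_tensor s q).

(* <a_1, ..., a_n>_b \otimes W_q(F) *)
Definition diag_Wq (s : seq F) : set (set (qform F)) :=
  [set witt_diag s C | C in Wq].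

(* \sum_(t in T) H t for a family H of subgroups of W_q(F): all finite sums of
   elements of the H t *)
Definition subgroup_sum (I : Type) (T : set I)
    (H : I -> set (set (qform F))) : set (set (qform F)) :=
  [set C | exists (n : nat) (t : 'I_n -> I) (D : 'I_n -> set (qform F)),
    (forall i, T (t i) /\ H (t i) (D i)) /\
    C = \big[witt_add/witt0]_(i < n) D i].

End Forms.

Section ScalarExtension.
Variables (F K : fieldType) (iota : {rmorphism F -> K}).

(* With respect to the standard basis e_i, q_K(x) is the sum of the
   q(e_i) x_i^2 and of the B_q(e_i, e_j) x_i x_j for i < j. *)
Definition ext_val (q : qform F) (x : 'rV[K]_(qdim q)) : K :=
  \sum_i iota (q (delta_mx 0 i)) * x 0 i ^+ 2 +
  \sum_(i < qdim q) \sum_(j < qdim q | (i < j)%N)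
    iota (polar q (delta_mx 0 i) (delta_mx 0 j)) * (x 0 i * x 0 j).

Lemma ext_is_quadratic (q : qform F) : is_quadratic (@ext_val q).
Proof.
have E x y : polar (@ext_val q) x y =
    \sum_i iota (q (delta_mx 0 i)) * (2 * (x 0 i * y 0 i)) +
    \sum_(i < qdim q) \sum_(j < qdim q | (i < j)%N)
      iota (polar q (delta_mx 0 i) (delta_mx 0 j)) *
      (x 0 i * y 0 j + y 0 i * x 0 j).
  rewrite /polar /ext_val !opprD !addrA.
  have R (a b c d e f : K) : a + b - c - d - e - f
    = (a - c - e) + (b - d - f) by ring.
  rewrite R {R}.
  rewrite -!sumrB; congr (_ + _); apply: eq_bigr => i _.
    by rewrite !mxE; ring.
  by rewrite -!sumrB; apply: eq_bigr => j _; rewrite !mxE; move: (iota _) => c; ring.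
split=> [a x|x a y z].
  rewrite /ext_val mulrDr !mulr_sumr; congr (_ + _); apply: eq_bigr => i _.
    by rewrite !mxE; ring.
  by rewrite mulr_sumr; apply: eq_bigr => j _; rewrite !mxE; move: (iota _) => c; ring.
rewrite !E mulrDr addrACA; congr (_ + _); rewrite mulr_sumr -big_split.
  by apply: eq_bigr => i _; rewrite /= !mxE; ring.
apply: eq_bigr => i _; rewrite /= mulr_sumr -big_split.
by apply: eq_bigr => j _; rewrite /= !mxE; move: (iota _) => c; ring.
Qed.

Definition qext (q : qform F) : qform K := QForm (ext_is_quadratic q).

Definition excellent : Prop :=
  forall q : qform F, exists (phi : qform F) (p : qform K),
    anisotropic_part (qext q) p /\ isometric p (qext phi).

Definition witt_ext (C : set (qform F)) : set (qform K) :=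
  \bigcup_(q in C) witt_class (qext q).

(* W_q(K/F) *)
Definition Wq_kernel : set (set (qform F)) :=
  [set C | Wq C /\ witt_ext C = @witt0 K].

(* The elements of F which are in K^{*2} *)
Definition nonzero_squares : set F :=
  [set t | exists2 x : K, x != 0 & iota t = x ^+ 2].

End ScalarExtension.

(* Main.v *)
From HB Require Import structures.
Require Import Defs.
From mathcomp Require Import all_boot all_order all_algebra ring.
From mathcomp Require Import boolp classical_sets.

(* Since K^2 lies in F, replacing a symplectic pair (e, f) by (w e, f / w) with
   w in K^* turns [a, b] into [a w^2, b / w^2], which is again defined over F.
   Over F it changes the Witt class by a <1, w^2>_b-multiple:
   [a, b] _|_ [a t, b / t] is isometric to <1, t>_b (x) [a, b].
   Given an isotropic vector of q_K, such scalings make all its coordinates on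
   the e_i equal to 0 or 1; a change of symplectic basis over F then leaves the
   vector e_1 + sum_i y_i f_i + z with y_1 = 0 and z in the radical, and scaling
   the f_i and the radical makes it a vector over F.  Thus an isotropic plane or
   line splits off over F, and after finitely many steps one reaches a form over
   F that is anisotropic over K. *)

Set Implicit Arguments.
Unset Strict Implicit.
Unset Printing Implicit Defensive.

Import GRing.Theory.
Local Open Scope ring_scope.

(** The obstacle is that the two coordinates of a vector on a pair (e_i, f_i) scale inversely, so
    they cannot both be normalised. Once the x_i are 0 or 1, the symplectic change over F collects
    the K-valued sum of the x_i y_i in a single coordinate, and isotropy decides: up to sign this
    sum is a combination, with coefficients in F, of squares of K, so it lies in F and can be
    absorbed into the new e_1. The resulting q', anisotropic over K and Witt equivalent to q over K,
    settles (i). For (ii), a nonsingular q has no radical, so its class over F moves only by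
    multiples of forms <1, t>_b. If moreover q_K is Witt trivial, then q'_K is anisotropic and
    trivial, so q' has dimension 0 and q is equivalent to the accumulated multiples. Conversely, t r
    becomes isometric to r when t is a square, and r _|_ r is hyperbolic for nonsingular r in
    characteristic 2. Since (i) concerns singular forms too, cancellation of hyperbolic planes and
    uniqueness of the anisotropic part are established for them as well. *)

Section Polar.
Variables (F : fieldType) (V : lmodType F) (q : V -> F).
Hypothesis qP : is_quadratic q.

Lemma quadZ a x : q (a *: x) = a ^+ 2 * q x.
Proof. by have [->] := qP. Qed.

Lemma quad0 : q 0 = 0.
Proof. by rewrite -(scale0r 0) quadZ expr0n mul0r. Qed.

Lemma quadN x : q (- x) = q x.
Proof. by rewrite -scaleN1r quadZ sqrrN expr1n mul1r. Qed.

Lemma quadD x y : q (x + y) = q x + q y + polar q x y.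
Proof. by rewrite /polar; ring. Qed.

Lemma polarC x y : polar q x y = polar q y x.
Proof. by rewrite /polar (addrC y); ring. Qed.

Lemma polarPr a x y z : polar q x (a *: y + z) = a * polar q x y + polar q x z.
Proof. by have [_ ->] := qP. Qed.

Lemma polar0r x : polar q x 0 = 0.
Proof. by rewrite /polar addr0 quad0; ring. Qed.

Lemma polarDr x y z : polar q x (y + z) = polar q x y + polar q x z.
Proof. by rewrite -[y]scale1r polarPr scale1r mul1r. Qed.

Lemma polarZr a x y : polar q x (a *: y) = a * polar q x y.
Proof. by rewrite -[a *: y]addr0 polarPr polar0r addr0. Qed.

Lemma polarNr x y : polar q x (- y) = - polar q x y.
Proof. by rewrite -scaleN1r polarZr mulN1r. Qed.

Lemma polarBr x y z : polar q x (y - z) = polar q x y - polar q x z.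
Proof. by rewrite polarDr polarNr. Qed.

Lemma polar0l x : polar q 0 x = 0. Proof. by rewrite polarC polar0r. Qed.

Lemma polarDl x y z : polar q (y + z) x = polar q y x + polar q z x.
Proof. by rewrite !(polarC _ x) polarDr. Qed.

Lemma polarZl a x y : polar q (a *: y) x = a * polar q y x.
Proof. by rewrite !(polarC _ x) polarZr. Qed.

Lemma polarBl x y z : polar q (y - z) x = polar q y x - polar q z x.
Proof. by rewrite !(polarC _ x) polarBr. Qed.

Lemma polarxx x : polar q x x = 2 * q x.
Proof. by rewrite /polar -mulr2n -scaler_nat quadZ; ring. Qed.

Lemma quad_comp (W : lmodType F) (f : {linear W -> V}) : is_quadratic (q \o f).
Proof.
split=> [a x|x a y z] /=; first by rewrite linearZ quadZ.
have E u v : polar (q \o f) u v = polar q (f u) (f v).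
  by rewrite /polar /= linearD.
by rewrite !E linearP polarPr.
Qed.

End Polar.

(** * Quadratic spaces, isometry and orthogonal sums *)

Definition lin (F : fieldType) (V W : lmodType F) (f : V -> W) (fP : linear f) :
  {linear V -> W} := HB.pack f (GRing.isLinear.Build F V W *:%R f fP).

(** Carriers are arbitrary modules, so that orthogonal sums live on product types, where
    commutativity and associativity hold without the dimension casts that row vectors would
    require. *)
Record qspace (F : fieldType) := QSpace {
  qcar : lmodType F;
  qfun :> qcar -> F;
  qfunP : is_quadratic qfun
}.

Definition qspace_of (F : fieldType) (q : qform F) : qspace F :=
  QSpace (qvalP q).
Coercion qspace_of : qform >-> qspace.

Section Iso.
Variable F : fieldType.
Implicit Types q r : qspace F.

Definition iso q r : Prop :=
  exists (f : {linear qcar q -> qcar r}) (g : qcar r -> qcar q),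
    [/\ cancel f g, cancel g f & forall x, r (f x) = q x].

Lemma isoI q r (f : qcar q -> qcar r) (g : qcar r -> qcar q) :
  linear f -> cancel f g -> cancel g f -> (forall x, r (f x) = q x) -> iso q r.
Proof. by move=> fP fK gK fq; exists (lin fP), g; split. Qed.

Lemma iso_eq (V : lmodType F) (f g : V -> F) (fP : is_quadratic f) (gP : is_quadratic g) :
  f =1 g -> iso (QSpace fP) (QSpace gP).
Proof. by move=> E; exists idfun, idfun; split=> // x; rewrite /= E. Qed.

Lemma iso_refl q : iso q q.
Proof. by exists idfun, idfun. Qed.

Lemma iso_sym q r : iso q r -> iso r q.
Proof.
case=> f [g [fK gK fq]].
apply: (@isoI _ _ g f) => // [a x y|x]; last by rewrite -fq gK.
by apply: (can_inj fK); rewrite linearP !gK.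
Qed.

Lemma iso_trans q r s : iso q r -> iso r s -> iso q s.
Proof.
move=> [f [g [fK gK fq]]] [f' [g' [fK' gK' fq']]].
exists (f' \o f), (g \o g'); split=> [||x /=]; last by rewrite fq' fq.
- exact: (can_comp fK' fK).
- exact: (can_comp gK gK').
Qed.

Lemma psum_quadratic q r :
  is_quadratic (fun x : (qcar q * qcar r)%type => q x.1 + r x.2).
Proof.
have E (x y : (qcar q * qcar r)%type) :
    polar (fun x : (qcar q * qcar r)%type => q x.1 + r x.2) x y =
    polar q x.1 y.1 + polar r x.2 y.2 by rewrite /polar /=; ring.
split=> [a x|x a y z].
  by rewrite /= (quadZ (qfunP q)) (quadZ (qfunP r)) mulrDr.
by rewrite !E /= (polarPr (qfunP q)) (polarPr (qfunP r)); ring.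
Qed.

Definition psum q r : qspace F := QSpace (psum_quadratic q r).

Lemma polar_psum q r (x y : qcar (psum q r)) :
  polar (psum q r) x y = polar q x.1 y.1 + polar r x.2 y.2.
Proof. by rewrite /polar /=; ring. Qed.

Lemma psum_iso q q' r r' : iso q q' -> iso r r' -> iso (psum q r) (psum q' r').
Proof.
move=> [f [g [fK gK fq]]] [f' [g' [fK' gK' fq']]].
apply: (@isoI (psum q r) (psum q' r') (fun x => (f x.1, f' x.2))
          (fun x => (g x.1, g' x.2))) => [a x y|[x y]|[x y]|x] /=.
- by rewrite !linearP.
- by rewrite fK fK'.
- by rewrite gK gK'.
- by rewrite fq fq'.
Qed.

Lemma psumC q r : iso (psum q r) (psum r q).
Proof.
by apply: (@isoI (psum q r) (psum r q) (fun x => (x.2, x.1))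
          (fun x => (x.2, x.1))) => [a x y|[x y]|[x y]|x] //=; rewrite addrC.
Qed.

Lemma psumA q r s : iso (psum q (psum r s)) (psum (psum q r) s).
Proof.
by apply: (@isoI (psum q (psum r s)) (psum (psum q r) s)
    (fun x => ((x.1, x.2.1), x.2.2)) (fun x => (x.1.1, (x.1.2, x.2))))
    => [a x y|[x [y z]]|[[x y] z]|x] //=; rewrite addrA.
Qed.

End Iso.

#[global] Hint Resolve iso_refl : core.

#[export] Instance iso_equiv (F : fieldType) :
  RelationClasses.Equivalence (@iso F).
Proof. by split; [exact: iso_refl|exact: iso_sym|exact: iso_trans]. Qed.

#[export] Instance psum_iso_proper (F : fieldType) :
  Morphisms.Proper
    (Morphisms.respectful (@iso F) (Morphisms.respectful (@iso F) (@iso F)))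
    (@psum F).
Proof. by move=> q q' qq' r r' rr'; apply: psum_iso. Qed.

Section Iso2.
Variable F : fieldType.
Implicit Types q r : qspace F.

Lemma psumACA q r s t :
  iso (psum (psum q r) (psum s t)) (psum (psum q s) (psum r t)).
Proof.
by rewrite -(psumA q) (psumA r) (psumC r s) -(psumA s) (psumA q).
Qed.

Lemma psumAC q r s : iso (psum (psum q r) s) (psum (psum q s) r).
Proof. by rewrite -(psumA q) (psumC r s) psumA. Qed.

Lemma perp_psum (q r : qform F) : iso (perp q r) (psum q r).
Proof.
apply: (@isoI _ (perp q r) (psum q r) (fun x => (lsubmx x, rsubmx x))
   (fun x => row_mx x.1 x.2)) => [a x y|x|[x y]|x] //=.
- by rewrite !linearP.
- by rewrite hsubmxK.
- by rewrite row_mxKl row_mxKr.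
Qed.

Lemma isometricE (q r : qform F) : isometric q r <-> iso q r.
Proof.
split=> [[f [[g fK gK] fq]]|[f [g [fK gK fq]]]]; first by exists f, g; split.
by exists f; split=> //; exists g.
Qed.

(** The matrices of the isometry and of its inverse multiply to the identity, which bounds one size
    by the other. The inductions on [qdim] rely on this. *)
Lemma iso_dim (q r : qform F) : iso q r -> qdim q = qdim r.
Proof.
have le (q' r' : qform F) : iso q' r' -> (qdim q' <= qdim r')%N.
  move=> [f [g [fK gK fq]]].
  have gP : linear g by move=> a x y; apply: (can_inj fK); rewrite linearP !gK.
  apply: (@mulmx1_min _ _ _ (lin1_mx f) (lin1_mx (lin gP))).
  apply/row_matrixP => i; rewrite row_mul row1 !rowE.
  by rewrite !mul_rV_lin1 /= fK.
by move=> H; apply/eqP; rewrite eqn_leq !le //; apply: iso_sym.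
Qed.

End Iso2.

(** * Cancellation of a hyperbolic plane *)

Section Cancellation.
Variable F : fieldType.
Implicit Types V W : qspace F.

(* W is the orthogonal sum of the hyperbolic plane with hyperbolic pair (e, f)
   and of the image of the isometric embedding i of V; r is the projection. *)
Definition hsplit W V (e f : qcar W) : Prop :=
  exists (i : {linear qcar V -> qcar W}) (r : {linear qcar W -> qcar V}),
  [/\ [/\ W e = 0, W f = 0 & polar W e f = 1],
      forall v, [/\ r (i v) = v, polar W (i v) e = 0, polar W (i v) f = 0
                  & W (i v) = V v]
    & forall w, i (r w) = w - polar W w f *: e - polar W w e *: f].

Lemma hsplitC W V e f : @hsplit W V e f -> @hsplit W V f e.
Proof.
move=> [i [r [[qe qf ef] iP rP]]]; exists i, r; split.
- by split=> //; rewrite (polarC W f e).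
- by move=> v; have [] := iP v.
- by move=> w; rewrite rP addrAC.
Qed.

Lemma hsplitZ W V e f a : a != 0 ->
  @hsplit W V e f -> @hsplit W V (a^-1 *: e) (a *: f).
Proof.
have WP := qfunP W.
move=> a0 [i [r [[qe qf ef] iP rP]]]; exists i, r; split.
- by rewrite !(quadZ WP) polarZl // polarZr // qe qf ef !mulr0 mulr1 mulVf.
- move=> v; have [ri ie if_ qi] := iP v; split=> //.
    by rewrite polarZr // ie mulr0.
  by rewrite polarZr // if_ mulr0.
- move=> w; rewrite rP !polarZr // !scalerA -mulrA (mulrC _ a^-1) mulrA divff //.
  by rewrite mul1r -mulrA (mulrC _ a) mulrA mulVf // mul1r.
Qed.

(** The new complement is a shear of the old one along [e]: subtracting B(v, g) e from v makes it
    orthogonal to [g], and changes neither its value nor its orthogonality to [e], because [e] is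
    isotropic and orthogonal to v. *)
Lemma hsplit_change W V e f g : W g = 0 -> polar W e g = 1 ->
  @hsplit W V e f -> @hsplit W V e g.
Proof.
have WP := qfunP W.
move=> qg eg [i [r [[qe qf ef] iP rP]]].
have ee : polar W e e = 0 by rewrite polarxx // qe mulr0.
have gg : polar W g g = 0 by rewrite polarxx // qg mulr0.
have re : r e = 0.
  have [<- _ _ _] := iP (r e).
  by rewrite rP ef ee scale1r scale0r subr0 subrr linear0.
have iP' : linear (fun v => i v - polar W (i v) g *: e).
  move=> a x y; rewrite linearP polarDl // polarZl // scalerBr scalerA scalerDl.
  by rewrite opprD addrACA.
have rP' : linear (fun w => r w - polar W w e *: r g).
  move=> a x y; rewrite linearP polarDl // polarZl // scalerBr scalerA scalerDl.
  by rewrite opprD addrACA.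
exists (lin iP'), (lin rP'); split=> //= [v|w].
  have [ri ie if_ qi] := iP v; split.
  - rewrite linearB linearZ /= re scaler0 subr0 ri polarBl // polarZl // ie ee.
    by rewrite mulr0 subr0 scale0r subr0.
  - by rewrite polarBl // polarZl // ie ee mulr0 subr0.
  - by rewrite polarBl // polarZl // eg mulr1 subrr.
  - rewrite quadD // quadN // quadZ // qe mulr0 addr0 polarNr // polarZr // ie.
    by rewrite mulr0 subr0.
pose x := w - polar W w e *: g.
have -> : r w - polar W w e *: r g = r x by rewrite linearB [r (_ *: _)]linearZ.
have xe : polar W x e = 0.
  by rewrite polarBl // polarZl // (polarC W g e) eg mulr1 subrr.
have xg : polar W x g = polar W w g.
  by rewrite polarBl // polarZl // gg mulr0 subr0.
rewrite rP xe scale0r subr0 [polar W (x - _) g]polarBl // polarZl // xg eg mulr1.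
move: (polar W x f) (polar W w g) => c d; rewrite scalerBl opprB addrA subrK.
by rewrite /x addrAC.
Qed.

(** Both spaces embed onto the same subspace of [W], the orthogonal complement of the plane spanned
    by [e] and [f]. *)
Lemma hsplit_iso W V V' e f : @hsplit W V e f -> @hsplit W V' e f -> iso V V'.
Proof.
have WP := qfunP W.
move=> [i [r [_ iP rP]]] [i' [r' [_ iP' rP']]].
have D v : i' (r' (i v)) = i v.
  by have [_ ie if_ _] := iP v; rewrite rP' ie if_ !scale0r !subr0.
have D' v : i (r (i' v)) = i' v.
  by have [_ ie if_ _] := iP' v; rewrite rP ie if_ !scale0r !subr0.
apply: (@isoI _ V V' (r' \o i) (r \o i')) => [a x y|v|v|v] /=.
- by rewrite !linearP.
- by rewrite D; have [] := iP v.
- by rewrite D'; have [] := iP' v.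
- by have [_ _ _ <-] := iP' (r' (i v)); rewrite D; have [] := iP v.
Qed.

(** The two hyperbolic pairs are joined by a chain in which each link replaces one vector, rescales,
    or swaps. If B(e, e') is nonzero, a multiple of e' completes [e] to a pair; otherwise an
    isotropic vector pairing with both [e] and e' serves as the intermediate link. *)
Lemma hsplit_cancel W V V' e f e' f' :
  @hsplit W V e f -> @hsplit W V' e' f' -> iso V V'.
Proof.
have WP := qfunP W.
move=> H H'.
have [_ [_ [[qe qf ef] _ _]]] := H; have [_ [_ [[qe' qf' ef'] _ _]]] := H'.
have [ee'|ee'] := eqVneq (polar W e e') 0; last first.
  set b := polar W e e' in ee'.
  have H1 := hsplitZ ee' H'.
  have E : polar W e (b^-1 *: e') = 1 by rewrite polarZr // mulVf.
  have H2 : hsplit V e (b^-1 *: e').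
    by apply: hsplit_change H => //; rewrite quadZ // qe' mulr0.
  apply: hsplit_iso H2 (hsplitC _).
  by apply: hsplit_change H1 => //; rewrite polarC.
(* One of [f], a multiple of f', or f + f' pairs nontrivially with both. *)
have [u eu e'u] : exists2 u, polar W e u = 1 & polar W e' u != 0.
  have [e'f|e'f] := eqVneq (polar W e' f) 0; last by exists f.
  have [ef2|ef2] := eqVneq (polar W e f') 0; last first.
    exists ((polar W e f')^-1 *: f'); first by rewrite polarZr // mulVf.
    by rewrite polarZr // ef' mulr1 invr_eq0.
  exists (f + f'); rewrite polarDr // ?ef ?ef2 ?addr0 //.
  by rewrite e'f ef' add0r oner_eq0.
(* The correction along [e] makes the vector isotropic and leaves its pairing with e' unchanged,
   since B(e, e') = 0. *)
pose g := u - W u *: e.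
have qg : W g = 0.
  rewrite quadD // quadN // quadZ // qe polarNr // polarZr // (polarC W u) eu.
  by ring.
have eg : polar W e g = 1.
  by rewrite polarBr // polarZr // polarxx // qe !mulr0 subr0.
have e'g : polar W e' g = polar W e' u.
  by rewrite polarBr // polarZr // (polarC W e' e) ee' mulr0 subr0.
rewrite -e'g in e'u; set b := polar W e' g in e'u.
have K1 := hsplitC (hsplit_change qg eg H).
have qbg : W (b^-1 *: g) = 0 by rewrite quadZ // qg mulr0.
have ebg : polar W e' (b^-1 *: g) = 1 by rewrite polarZr // mulVf.
have K2 := hsplitZ e'u (hsplit_change qbg ebg H').
rewrite scalerA divff // scale1r in K2.
have [_ [_ [[qe2 _ ge2] _ _]]] := K2.
apply: hsplit_iso (hsplitC K2); apply: hsplit_change K1 => //.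
by rewrite polarC.
Qed.

End Cancellation.

(** * Diagonalised forms and uniqueness of the anisotropic part *)

Section NormalForms.
Variable F : fieldType.

Definition pf_val n (a b : 'I_n -> F) (x : ('rV[F]_n * 'rV[F]_n)%type) : F :=
  \sum_i (a i * x.1 0 i ^+ 2 + x.1 0 i * x.2 0 i + b i * x.2 0 i ^+ 2).

Lemma polar_pf_val n (a b : 'I_n -> F) x y :
  polar (pf_val a b) x y =
  \sum_i (2 * a i * x.1 0 i * y.1 0 i + (x.1 0 i * y.2 0 i + y.1 0 i * x.2 0 i)
          + 2 * b i * x.2 0 i * y.2 0 i).
Proof.
by rewrite /polar /pf_val -!sumrB; apply: eq_bigr => i _; rewrite !mxE; ring.
Qed.

Lemma pf_quadratic n (a b : 'I_n -> F) : is_quadratic (pf_val a b).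
Proof.
split=> [c x|x c y z].
  by rewrite /pf_val mulr_sumr; apply: eq_bigr => i _; rewrite !mxE; ring.
rewrite !polar_pf_val mulr_sumr -big_split.
by apply: eq_bigr => i _; rewrite /= !mxE; ring.
Qed.

(* [a_1, b_1] _|_ ... _|_ [a_n, b_n] *)
Definition pf n (a b : 'I_n -> F) : qspace F := QSpace (pf_quadratic a b).

Definition tf_val m (c : 'I_m -> F) (x : 'rV[F]_m) : F :=
  \sum_i c i * x 0 i ^+ 2.

Lemma polar_tf_val m (c : 'I_m -> F) x y :
  polar (tf_val c) x y = \sum_i 2 * c i * x 0 i * y 0 i.
Proof.
by rewrite /polar /tf_val -!sumrB; apply: eq_bigr => i _; rewrite !mxE; ring.
Qed.

Lemma tf_quadratic m (c : 'I_m -> F) : is_quadratic (tf_val c).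
Proof.
split=> [d x|x d y z].
  by rewrite /tf_val mulr_sumr; apply: eq_bigr => i _; rewrite !mxE; ring.
rewrite !polar_tf_val mulr_sumr -big_split.
by apply: eq_bigr => i _; rewrite /= !mxE; ring.
Qed.

(* <c_1, ..., c_m> *)
Definition tf m (c : 'I_m -> F) : qspace F := QSpace (tf_quadratic c).

(** The forms that Witt equivalence discards: hyperbolic planes and a zero form. *)
Definition Zf k m : qspace F :=
  psum (pf (fun _ : 'I_k => 0) (fun => 0)) (tf (fun _ : 'I_m => 0)).

Lemma pf_add n1 n2 (a b : 'I_(n1 + n2) -> F) :
  iso (pf a b) (psum (pf (a \o @lshift n1 n2) (b \o @lshift n1 n2))
                     (pf (a \o @rshift n1 n2) (b \o @rshift n1 n2))).
Proof.
apply: (@isoI _ (pf a b) (psum (pf _ _) (pf _ _))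
  (fun x => ((lsubmx x.1, lsubmx x.2), (rsubmx x.1, rsubmx x.2)))
  (fun x => (row_mx x.1.1 x.2.1, row_mx x.1.2 x.2.2)))
  => [c x y|[x y]|[[x y] [x' y']]|[x y]] /=.
- by rewrite !linearP.
- by rewrite !hsubmxK.
- by rewrite !row_mxKl !row_mxKr.
- rewrite /pf_val big_split_ord /=; congr (_ + _);
  by apply: eq_bigr => i _; rewrite !mxE.
Qed.

Lemma tf_add n1 n2 (c : 'I_(n1 + n2) -> F) :
  iso (tf c) (psum (tf (c \o @lshift n1 n2)) (tf (c \o @rshift n1 n2))).
Proof.
apply: (@isoI _ (tf c) (psum (tf _) (tf _)) (fun x => (lsubmx x, rsubmx x))
  (fun x => row_mx x.1 x.2)) => [d x y|x|[x y]|x] /=.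
- by rewrite !linearP.
- by rewrite hsubmxK.
- by rewrite row_mxKl row_mxKr.
- rewrite /tf_val big_split_ord /=; congr (_ + _);
  by apply: eq_bigr => i _; rewrite !mxE.
Qed.

Lemma Zf_add k1 k2 m1 m2 :
  iso (Zf (k1 + k2) (m1 + m2)) (psum (Zf k1 m1) (Zf k2 m2)).
Proof. by rewrite /Zf pf_add tf_add; exact: psumACA. Qed.

Lemma psum_null (q r : qspace F) : (forall x : qcar r, x = 0) ->
  iso (psum q r) q.
Proof.
move=> r0; apply: (@isoI _ (psum q r) q fst (fun x => (x, 0)))
  => [//|[x y]|//|[x y]] /=; first by rewrite (r0 y).
by rewrite (r0 y) (quad0 (qfunP r)) addr0.
Qed.

Lemma null_iso (q r : qspace F) :
  (forall x : qcar q, x = 0) -> (forall x : qcar r, x = 0) -> iso q r.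
Proof.
move=> q0 r0; apply: (@isoI _ q r (fun => 0) (fun => 0)) => [a x y|x|x|x].
- by rewrite scaler0 addr0.
- by rewrite (q0 x).
- by rewrite (r0 x).
- by rewrite (q0 x) (quad0 (qfunP q)) (quad0 (qfunP r)).
Qed.

Lemma rV0 (x : 'rV[F]_0) : x = 0. Proof. by apply/rowP; case. Qed.

Lemma Zf00_null (x : qcar (Zf 0 0)) : x = 0.
Proof. by case: x => [[x y] z]; rewrite (rV0 x) (rV0 y) (rV0 z). Qed.

Lemma psumZ00 q : iso (psum q (Zf 0 0)) q.
Proof. by apply: psum_null; exact: Zf00_null. Qed.

Definition hyp : qspace F := pf (fun _ : 'I_1 => 0) (fun => 0).

Lemma ZfS k m : iso (Zf k.+1 m) (psum hyp (Zf k m)).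
Proof. by rewrite /Zf -[k.+1]/(1 + k)%N pf_add psumA. Qed.

Lemma hypE (x : qcar hyp) : hyp x = x.1 0 0 * x.2 0 0.
Proof. by rewrite /= /pf_val big_ord1; ring. Qed.

Lemma polar_hyp (x y : qcar hyp) :
  polar hyp x y = x.1 0 0 * y.2 0 0 + y.1 0 0 * x.2 0 0.
Proof. by rewrite /= polar_pf_val big_ord1; ring. Qed.

Lemma hsplit_hyp (V : qspace F) :
  @hsplit _ (psum hyp V) V ((const_mx 1, 0), 0) ((0, const_mx 1), 0).
Proof.
have VP := qfunP V.
have iP : linear ((fun v => (0, v)) : qcar V -> qcar (psum hyp V)).
  by move=> a x y; rewrite /= -[RHS]/(_, _) /= scaler0 addr0.
have rP : linear (snd : qcar (psum hyp V) -> qcar V) by [].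
exists (lin iP), (lin rP); split=> [|v|w].
- split.
  + by rewrite -[LHS]/(hyp _ + V _) hypE /= !mxE mulr0 (quad0 VP) addr0.
  + by rewrite -[LHS]/(hyp _ + V _) hypE /= !mxE mul0r (quad0 VP) addr0.
  + by rewrite polar_psum polar_hyp /= polar0l // !mxE; ring.
- split=> //.
  + by rewrite polar_psum polar_hyp /= polar0r // !mxE; ring.
  + by rewrite polar_psum polar_hyp /= polar0r // !mxE; ring.
  + by rewrite -[LHS]/(hyp _ + V _) hypE /= !mxE mul0r add0r.
- case: w => [[x y] v]; rewrite !polar_psum !polar_hyp /= !polar0r // !mxE.
  rewrite mul0r mulr0 mulr1 mul1r !addr0 !add0r.
  congr ((_, _), _); last by rewrite /= !scaler0 !subr0.
    by apply/rowP => i; rewrite !mxE (ord1 i); ring.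
  by apply/rowP => i; rewrite !mxE (ord1 i); ring.
Qed.

Lemma hsplit_isoW (W W' V : qspace F) e f : iso W W' ->
  @hsplit _ W V e f -> exists e' f', @hsplit _ W' V e' f'.
Proof.
move=> [h [g [hK gK hq]]] [i [r [[qe qf ef] iP rP]]].
have gP : linear g by move=> a x y; apply: (can_inj hK); rewrite linearP !gK.
have hp x y : polar W' (h x) (h y) = polar W x y.
  by rewrite /polar -linearD !hq.
exists (h e), (h f), (h \o i), (r \o lin gP); split.
- by rewrite !hq hp.
- move=> v; rewrite /= hK !hp hq; exact: iP.
- move=> w; rewrite -(gK w) !hp /= hK rP !(linearB h).
  by rewrite [h (_ *: e)]linearZ [h (_ *: f)]linearZ.
Qed.

Lemma hyp_cancel (V V' : qspace F) : iso (psum hyp V) (psum hyp V') -> iso V V'.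
Proof.
move=> H; have [e [f H']] := hsplit_isoW H (hsplit_hyp V).
exact: hsplit_cancel H' (hsplit_hyp V').
Qed.

Definition anis (q : qspace F) := forall x, q x = 0 -> x = 0.

Lemma Zf0 m (z : qcar (Zf 0 m)) : Zf 0 m z = 0.
Proof.
rewrite /= /pf_val big_ord0 add0r /tf_val big1 // => i _; exact: mul0r.
Qed.

(** Discarding the zero parts of an isometry preserves values. It remains invertible because the
    discarded vector is isotropic, so the inverse isometry sends it to a vector whose component in
    the anisotropic space is isotropic, hence zero. *)
Lemma anis_zero_iso (p p' : qspace F) m m' : anis p -> anis p' ->
  iso (psum p (Zf 0 m)) (psum p' (Zf 0 m')) -> iso p p'.
Proof.
have key (q q' : qspace F) n n' (f : {linear qcar (psum q (Zf 0 n)) ->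
     qcar (psum q' (Zf 0 n'))}) g : anis q -> anis q' -> cancel f g ->
     cancel g f -> (forall x, psum q' (Zf 0 n') (f x) = psum q (Zf 0 n) x) ->
     forall v, (g ((f (v, 0)).1, 0)).1 = v.
  move=> an an' fK gK fq v.
  have gP : linear g by move=> a x y; apply: (can_inj fK); rewrite linearP !gK.
  case E: (f (v, 0)) => [w z] /=.
  have -> : (w, 0) = f (v, 0) - (0, z) :> qcar (psum q' (Zf 0 n')).
    by rewrite E; congr (_, _); rewrite /= ?subr0 ?subrr.
  rewrite -[g]/(lin gP : _ -> _) linearB /= fK /=.
  rewrite (_ : (g (0, z)).1 = 0) ?subr0 //.
  apply: an; have := fq (g (0, z)); rewrite gK.
  by rewrite -[LHS]/(q' 0 + Zf 0 n' z) -[RHS]/(q _ + Zf 0 n _) !Zf0 !addr0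
     (quad0 (qfunP q')).
move=> an an' [f [g [fK gK fq]]].
have gP : linear g by move=> a x y; apply: (can_inj fK); rewrite linearP !gK.
apply: (@isoI _ p p' (fun v => (f (v, 0)).1) (fun w => (g (w, 0)).1)).
- move=> a x y; have -> : (a *: x + y, 0) = a *: (x, 0) + (y, 0)
    :> qcar (psum p (Zf 0 m)) by congr (_, _); rewrite /= scaler0 addr0.
  by rewrite linearP.
- exact: key.
- apply: (key _ _ _ _ (lin gP) f) => // x; by rewrite -fq /= gK.
- move=> v; have := fq (v, 0).
  by rewrite -[LHS]/(p' _ + Zf 0 m' _) -[RHS]/(p _ + Zf 0 m _) !Zf0 !addr0.
Qed.

(** On the left, an isotropic vector has zero component in [p], so it lies in the radical and cannot
    belong to a hyperbolic pair. *)
Lemma anis_Zf_notiso (p p' : qspace F) k m m' : anis p ->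
  ~ iso (psum p (Zf 0 m)) (psum p' (Zf k.+1 m')).
Proof.
move=> an.
have -> : iso (psum p' (Zf k.+1 m')) (psum hyp (psum p' (Zf k m'))).
  by rewrite ZfS psumA (psumC p') psumA.
move=> H; have := hsplit_hyp (psum p' (Zf k m')).
move/(hsplit_isoW (iso_sym H)) => [[x z] [[x' z'] [i [r [[qe _ ef] _ _]]]]].
have x0 : x = 0.
  by apply: an; move: qe; rewrite -[LHS]/(p _ + Zf 0 m _) Zf0 addr0.
move: ef; rewrite x0 polar_psum (polar0l (qfunP p)) add0r.
by rewrite /polar !Zf0 !subr0 => /eqP; rewrite eq_sym oner_eq0.
Qed.

(** Hyperbolic planes are cancelled one by one from both sides; they must run out simultaneously. *)
Lemma anis_uniq (p p' : qspace F) k l m m' : anis p -> anis p' ->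
  iso (psum p (Zf k m)) (psum p' (Zf l m')) -> iso p p'.
Proof.
move=> an an'; elim: k l => [|k IH] [|l] H.
- exact: anis_zero_iso H.
- by case: (anis_Zf_notiso an H).
- by case: (anis_Zf_notiso an' (iso_sym H)).
apply: (IH l); apply: hyp_cancel.
by rewrite !psumA !(psumC hyp) -!psumA -!ZfS.
Qed.

End NormalForms.

(** * Witt equivalence as stable isometry *)

Section WittEquivalence.
Variable F : fieldType.
Implicit Types q r s : qspace F.

(** Stable isometry makes transitivity and compatibility with sums formal, with no appeal to
    anisotropic parts; [witt_equivE] identifies it with Witt equivalence in characteristic 2. *)
Definition weq q r : Prop :=
  exists k m l m', iso (psum q (Zf F k m)) (psum r (Zf F l m')).

Lemma iso_weq q r : iso q r -> weq q r.
Proof. by move=> H; exists 0%N, 0%N, 0%N, 0%N; rewrite H. Qed.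

Lemma weq_refl q : weq q q.
Proof. exact: iso_weq. Qed.

Lemma weq_sym q r : weq q r -> weq r q.
Proof. by move=> [k [m [l [m' H]]]]; exists l, m', k, m; symmetry. Qed.

Lemma weq_trans q r s : weq q r -> weq r s -> weq q s.
Proof.
move=> [k [m [l [n H]]]] [k' [m' [l' [n' H']]]].
exists (k + k')%N, (m + m')%N, (l + l')%N, (n + n')%N.
by rewrite !Zf_add psumA H psumAC H' psumAC -psumA.
Qed.

Lemma weq_psum q q' r r' : weq q q' -> weq r r' -> weq (psum q r) (psum q' r').
Proof.
move=> [k [m [l [n H]]]] [k' [m' [l' [n' H']]]].
exists (k + k')%N, (m + m')%N, (l + l')%N, (n + n')%N.
by rewrite !Zf_add psumACA H H' psumACA.
Qed.

Lemma weq_Zf q k m : weq (psum q (Zf F k m)) q.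
Proof. by exists 0%N, 0%N, k, m; rewrite psumZ00. Qed.

End WittEquivalence.

#[global] Hint Resolve weq_refl : core.

#[export] Instance weq_equiv (F : fieldType) :
  RelationClasses.Equivalence (@weq F).
Proof.
by split; [exact: weq_refl|exact: weq_sym|exact: weq_trans].
Qed.

#[export] Instance psum_weq_proper (F : fieldType) :
  Morphisms.Proper
    (Morphisms.respectful (@weq F) (Morphisms.respectful (@weq F) (@weq F)))
    (@psum F).
Proof. by move=> q q' qq' r r' rr'; apply: weq_psum. Qed.

#[export] Instance iso_weq_subrel (F : fieldType) :
  RelationClasses.subrelation (@iso F) (@weq F).
Proof. by move=> q r; exact: iso_weq. Qed.

(** * Splitting off planes and radical lines in characteristic 2 *)

Section Decomposition.
Variable F : fieldType.

(** Coordinates on a kernel, so that a complement cut out by linear equations is again a form on row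
    vectors. *)
Lemma ker_coords d p (g : {linear 'rV[F]_d -> 'rV[F]_p}) :
  exists r (i : {linear 'rV[F]_r -> 'rV[F]_d})
    (s : {linear 'rV[F]_d -> 'rV[F]_r}),
  [/\ forall z, g (i z) = 0, forall z, s (i z) = z
    & forall w, g w = 0 -> i (s w) = w].
Proof.
pose N := row_base (kermx (lin1_mx g)).
have Nfree : row_free N by exact: row_base_free.
exists _, (mulmxr N), (mulmxr (pinvmx N)); split=> [z|z|w gw] /=.
- rewrite -mul_rV_lin1 -mulmxA (_ : N *m _ = 0) ?mulmx0 //.
  by apply/sub_kermxP; rewrite eq_row_base.
- by rewrite -mulmxA mulmxVp // mulmx1.
- by rewrite mulmxKpV // eq_row_base; apply/sub_kermxP; rewrite mul_rV_lin1.
Qed.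

Hypothesis char2 : 2 = 0 :> F.

Lemma polarxx0 (V : lmodType F) (q : V -> F) x :
  is_quadratic q -> polar q x x = 0.
Proof. by move=> qP; rewrite polarxx // char2 mul0r. Qed.

(** In characteristic 2 the polar form is alternating, so [e] and [f] span a nonsingular plane
    whatever their values, and w - B(w, f) e - B(w, e) f is the projection to its orthogonal
    complement. *)
Lemma split_pair (q : qform F) (e f : 'rV_(qdim q)) : polar q e f = 1 ->
  exists q' : qform F,
    iso q (psum (pf (fun _ : 'I_1 => q e) (fun => q f)) q').
Proof.
have qP := qvalP q; move=> ef.
have ee : polar q e e = 0 := polarxx0 e qP.
have ff : polar q f f = 0 := polarxx0 f qP.
have fe : polar q f e = 1 by rewrite polarC.
have gP : linear (fun w => row_mx (const_mx (polar q w e))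
     (const_mx (polar q w f)) : 'rV[F]_(1 + 1)).
  move=> a x y; rewrite !polarDl // !polarZl // scale_row_mx add_row_mx.
  by congr row_mx; apply/rowP => j; rewrite !mxE.
have [r [i [s [gi si is_]]]] := ker_coords (lin gP).
have ie z : polar q (i z) e = 0.
  have /(congr1 lsubmx) := gi z; rewrite /= row_mxKl => /rowP/(_ 0).
  by rewrite !mxE.
have if_ z : polar q (i z) f = 0.
  have /(congr1 rsubmx) := gi z; rewrite /= row_mxKr => /rowP/(_ 0).
  by rewrite !mxE.
pose q' := QForm (quad_comp qP i); exists q'; symmetry.
apply: (@isoI _ (psum (pf _ _) q') q
  (fun x => x.1.1 0 0 *: e + x.1.2 0 0 *: f + i x.2)
  (fun w => ((const_mx (polar q w f), const_mx (polar q w e)),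
     s (w - polar q w f *: e - polar q w e *: f)))).
- move=> a [[x y] z] [[x' y'] z'] /=; rewrite !mxE linearP !scalerDr !scalerDl.
  by rewrite !scalerA [RHS]addrACA [X in _ = X + _]addrACA.
- move=> [[x y] z] /=.
  rewrite !polarDl // !polarZl // ee ef fe ff ie if_ !mulr0 !mulr1 !addr0 !add0r.
  congr ((_, _), _).
  + by apply/rowP => j; rewrite mxE (ord1 j).
  + by apply/rowP => j; rewrite mxE (ord1 j).
  + by rewrite -addrA -opprD addrAC subrr add0r si.
- move=> w /=; rewrite !mxE is_ /=.
    by rewrite -[w - _ - _]addrA -opprD [LHS]addrC subrK.
  rewrite -row_mx0; congr row_mx; apply/rowP => j; rewrite !mxE.
    by rewrite !polarBl // !polarZl // ee fe; ring.
  by rewrite !polarBl // !polarZl // ef ff; ring.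
- move=> [[x y] z] /=; rewrite /pf_val big_ord1 /=.
  rewrite !(quadD (@qval _ q)) !(quadZ qP) !(polarDl qP) !(polarZl qP) (polarZr qP).
  by rewrite ef !(polarC _ _ (i z)) ie if_; ring.
Qed.

(** Any complement of a radical line is orthogonal to it; the one chosen is the hyperplane where
    some nonzero coordinate of [e] vanishes. *)
Lemma split_rad (q : qform F) (e : 'rV_(qdim q)) : e != 0 -> q e = 0 ->
  (forall w, polar q e w = 0) ->
  exists q' : qform F, iso q (psum (tf (fun _ : 'I_1 => 0)) q').
Proof.
have qP := qvalP q; move=> e0 qe ew.
have [j ej] : exists j, e 0 j != 0.
  apply/existsP; apply: contraNT e0 => /existsPn e0; apply/eqP/rowP => j.
  by rewrite mxE; apply/eqP; rewrite -[_ == _]negbK e0.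
have gP : linear (fun w : 'rV[F]_(qdim q) => const_mx (w 0 j / e 0 j)
     : 'rV[F]_1).
  by move=> a x y; apply/rowP => k; rewrite !mxE mulrDl mulrA.
have [r [i [s [gi si is_]]]] := ker_coords (lin gP).
have ie z : i z 0 j = 0.
  have /rowP/(_ 0) := gi z; rewrite !mxE => /eqP.
  by rewrite mulf_eq0 invr_eq0 (negPf ej) orbF => /eqP.
pose q' := QForm (quad_comp qP i); exists q'; symmetry.
apply: (@isoI _ (psum (tf _) q') q (fun x => x.1 0 0 *: e + i x.2)
  (fun w => (const_mx (w 0 j / e 0 j), s (w - (w 0 j / e 0 j) *: e)))).
- move=> a [x z] [x' z'] /=; rewrite !mxE linearP !scalerDr !scalerDl scalerA.
  by rewrite addrACA.
- move=> [x z] /=; rewrite !mxE ie addr0 mulfK // [_ *: e + _]addrC addrK si.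
  by congr (_, _); apply/rowP => k; rewrite mxE (ord1 k).
- move=> w /=; rewrite !mxE is_ /=; first by rewrite [LHS]addrC subrK.
  by apply/rowP => k; rewrite !mxE mulfVK // subrr mul0r.
- move=> [x z] /=; rewrite /tf_val big_ord1 mul0r add0r /=.
  rewrite (quadD (@qval _ q)) (quadZ qP) (polarZl qP).
  rewrite (qe : @qval _ q e = 0) (ew _ : polar (@qval _ q) e _ = 0).
  by rewrite !mulr0 add0r addr0.
Qed.

(** Row-vector copies of the normal forms are needed because scalar extension and dimension exist
    only for [qform]. *)
Lemma pfq_quadratic n (a b : 'I_n -> F) :
  is_quadratic (fun x : 'rV[F]_(n + n) => pf a b (lsubmx x, rsubmx x)).
Proof.
have fP : linear (fun x : 'rV[F]_(n + n) => (lsubmx x, rsubmx x)).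
  by move=> c x y; rewrite !linearP.
exact: (quad_comp (pf_quadratic a b) (lin fP)).
Qed.

Definition pfq n (a b : 'I_n -> F) : qform F := QForm (pfq_quadratic a b).

Lemma pfq_iso n (a b : 'I_n -> F) : iso (pfq a b) (pf a b).
Proof.
apply: (@isoI _ (pfq a b) (pf a b) (fun x => (lsubmx x, rsubmx x))
   (fun x => row_mx x.1 x.2)) => [c x y|x|[x y]|x] //=.
- by rewrite !linearP.
- by rewrite hsubmxK.
- by rewrite row_mxKl row_mxKr.
Qed.

Definition tfq m (c : 'I_m -> F) : qform F := QForm (tf_quadratic c).

(** An isotropic vector either lies in the radical and splits off a zero line, or belongs to a
    hyperbolic pair. The strict drop in dimension drives the later inductions. *)
Lemma reduce (q : qform F) (x : 'rV_(qdim q)) : x != 0 -> q x = 0 ->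
  exists (q' : qform F) k m,
    (qdim q' < qdim q)%N /\ iso q (psum q' (Zf F k m)).
Proof.
have qP := qfunP q; move=> x0 qx.
have [[y xy]|xV] := pselect (exists y, polar q x y != 0); last first.
  have [|q' H] := split_rad x0 qx.
    by move=> w; apply/eqP/negP => /negP h; apply: xV; exists w.
  exists q', 0%N, 1%N; split; last first.
    rewrite H psumC; apply: psum_iso => //; rewrite /Zf psumC; symmetry.
    by apply: psum_null => -[u v]; rewrite (rV0 u) (rV0 v).
  rewrite (iso_dim (iso_trans H _ : iso q (perp (tfq (fun _ : 'I_1 => 0)) q'))).
    by rewrite /= add1n.
  by rewrite perp_psum.
have [z xz] : exists z, polar q x z = 1.
  by exists ((polar q x y)^-1 *: y); rewrite polarZr // mulVf.
(* As [x] is isotropic and B(x, z) = 1, the multiple q(z) of [x] is the one whose subtraction makes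
   [z] isotropic. *)
pose f := z - q z *: x.
have xf : polar q x f = 1.
  by rewrite polarBr // polarZr // xz (polarxx0 x qP) mulr0 subr0.
have qf : q f = 0.
  rewrite quadD // quadN // quadZ // qx polarNr // polarZr // (polarC _ z) xz.
  by ring.
have [q' H] := split_pair xf; rewrite qx qf in H.
exists q', 1%N, 0%N; split; last first.
  rewrite H psumC; apply: psum_iso => //; rewrite /Zf; symmetry.
  by apply: psum_null => u; rewrite (rV0 u).
rewrite (iso_dim (iso_trans H _ : iso q (perp (pfq (fun _ : 'I_1 => 0)
   (fun => 0)) q'))).
  by rewrite /= ltnS leqnSn.
by rewrite perp_psum pfq_iso.
Qed.

Lemma anis_part_exists (q : qform F) :
  exists (p : qform F) k m, anis p /\ iso q (psum p (Zf F k m)).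
Proof.
have [d] := ubnP (qdim q); elim: d q => // d IH q dq.
have [an|] := pselect (anis q).
  by exists q, 0%N, 0%N; split=> //; rewrite psumZ00.
move/existsNP => [x /not_implyP[qx /eqP x0]].
have [q' [k [m [dq' H]]]] := reduce x0 qx.
have [|p [k' [m' [an H']]]] := IH q'; first exact: leq_trans dq' _.
by exists p, (k' + k)%N, (m' + m)%N; split=> //; rewrite H H' Zf_add psumA.
Qed.

(** Planes [a, b] are split off while the polar form is nonzero. Once it vanishes, the form is
    additive, hence diagonal in the standard basis. *)
Lemma decomp (q : qform F) : exists n m (a b : 'I_n -> F) (c : 'I_m -> F),
  iso q (psum (pf a b) (tf c)).
Proof.
have qP := qfunP q.
have [d] := ubnP (qdim q); elim: d q qP => // d IH q qP dq.
have [[x [y xy]]|q0] := pselect (exists x y, polar q x y != 0); last first.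
  exists 0%N, (qdim q), (fun => 0), (fun => 0), (fun i => q (delta_mx 0 i)).
  rewrite psumC psum_null; last by case=> u v; rewrite (rV0 u) (rV0 v).
  have qD x y : q (x + y) = q x + q y.
    rewrite quadD // (_ : polar q x y = 0) ?addr0 //.
    by apply/eqP/negP => /negP h; apply: q0; exists x, y.
  apply: iso_eq => x; change (@qfun F q x = tf_val (fun i => q (delta_mx 0 i)) x).
  rewrite {1}(row_sum_delta x) (big_morph (@qfun F q) qD (quad0 qP)).
  by apply: eq_bigr => i _; rewrite quadZ // mulrC.
have [z xz] : exists z, polar q x z = 1.
  by exists ((polar q x y)^-1 *: y); rewrite polarZr // mulVf.
have [q' H] := split_pair xz.
have [||n [m [a [b [c H']]]]] := IH q'; first exact: qfunP.
  rewrite (iso_dim (iso_trans H _ : iso q (perp (pfq (fun _ : 'I_1 => q x)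
   (fun => q z)) q'))) in dq; last by rewrite perp_psum pfq_iso.
  exact: ltnW dq.
exists (1 + n)%N, m, (fun i => match split i with inl _ => q x | inr j => a j end),
  (fun i => match split i with inl _ => q z | inr j => b j end), c.
apply: (iso_trans H); rewrite H' psumA; apply: psum_iso => //; rewrite pf_add.
by apply: psum_iso; apply: iso_eq => u; apply: eq_bigr => i _;
  rewrite /= ?(unsplitK (inl _)) ?(unsplitK (inr _)).
Qed.

Lemma qzero_iso m : iso (qzero F m) (tf (fun _ : 'I_m => 0)).
Proof.
by apply: iso_eq => x; rewrite /= /tf_val big1 // => i _; rewrite mul0r.
Qed.

Lemma qbinary_iso (a b : F) :
  iso (qbinary a b) (pf (fun _ : 'I_1 => a) (fun => b)).
Proof.
symmetry; apply: (@isoI _ (pf _ _) (qbinary a b)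
   (fun x => row_mx x.1 x.2 : 'rV_(1 + 1))
   (fun x : 'rV_(1 + 1) => (lsubmx x, rsubmx x))) => [c x y|[x y]|x|[x y]] /=.
- suff E : row_mx (c *: x.1 + y.1) (c *: x.2 + y.2) =
    c *: row_mx x.1 x.2 + row_mx y.1 y.2 :> 'rV_(1 + 1) by exact: E.
  by rewrite scale_row_mx add_row_mx.
- by rewrite row_mxKl row_mxKr.
- by rewrite hsubmxK.
- have E0 : row_mx x y 0 (0 : 'I_2) = x 0 0.
    rewrite -(row_mxEl x y); congr (row_mx x y 0 _); exact: val_inj.
  have E1 : row_mx x y 0 (1 : 'I_2) = y 0 0.
    rewrite -(row_mxEr x y); congr (row_mx x y 0 _); exact: val_inj.
  by rewrite E0 E1 /pf_val big_ord1.
Qed.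

Lemma qcopies_iso k :
  iso (qcopies k (hyperbolic_plane F)) (pf (fun _ : 'I_k => 0) (fun => 0)).
Proof.
elim: k => [|k IH]; first by apply: null_iso => [x|[x y]]; rewrite (rV0 x) ?(rV0 y).
by rewrite /= perp_psum -[k.+1]/(1 + k)%N pf_add IH qbinary_iso.
Qed.

Lemma anisotropic_partE (q p : qform F) :
  anisotropic_part q p <-> anis p /\ exists k m, iso q (psum p (Zf F k m)).
Proof.
have E k m : iso (perp (qcopies k (hyperbolic_plane F)) (perp p (qzero F m)))
     (psum p (Zf F k m)).
  rewrite !perp_psum qcopies_iso qzero_iso /Zf psumA (psumC _ p).
  by rewrite psumA.
split=> -[an [k [m H]]]; split=> //; exists k, m.
  by rewrite -E; apply/isometricE.
by apply/isometricE; rewrite E.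
Qed.

(** Existence of anisotropic parts gives the witnesses, and their uniqueness up to isometry turns
    stable isometry into isometry of these parts. *)
Lemma witt_equivE (q r : qform F) : witt_equiv q r <-> weq q r.
Proof.
split=> [[p [p' [/anisotropic_partE[_ [k [m H]]]
     /anisotropic_partE[_ [k' [m' H']]] /isometricE pp']]]|[k [m [k' [m' H]]]]].
  by rewrite H H' pp' !weq_Zf.
have [p [l [n [an E]]]] := anis_part_exists q.
have [p' [l' [n' [an' E']]]] := anis_part_exists r.
exists p, p'; split.
- by apply/anisotropic_partE; split=> //; exists l, n.
- by apply/anisotropic_partE; split=> //; exists l', n'.
apply/isometricE; move: H; rewrite E E' -(psumA p) -(psumA p') -!Zf_add.
exact: anis_uniq.
Qed.

Lemma anis_weq_iso (p p' : qspace F) : anis p -> anis p' -> weq p p' -> iso p p'.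
Proof. by move=> an an' [k [m [k' [m' H]]]]; apply: anis_uniq H. Qed.

Definition nonsing (q : qspace F) :=
  forall x, (forall y, polar q x y = 0) -> x = 0.

Lemma nonsing_iso (q r : qspace F) : iso q r -> nonsing q -> nonsing r.
Proof.
move=> [f [g [fK gK fq]]] ns x xr.
have gP : linear g by move=> a u v; apply: (can_inj fK); rewrite linearP !gK.
rewrite -(gK x) (ns (g x)) ?linear0 // => y.
by rewrite -(xr (f y)) /polar -!fq linearD gK.
Qed.

Lemma nonsing_psum (q r : qspace F) :
  nonsing (psum q r) <-> nonsing q /\ nonsing r.
Proof.
have [qP rP] := (qfunP q, qfunP r).
split=> [ns|[nq nr] [x y] xy]; last first.
  congr (_, _).
    apply: nq => z; have := xy (z, 0); rewrite polar_psum /= polar0r //.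
    by rewrite addr0.
  apply: nr => z; have := xy (0, z); rewrite polar_psum /= polar0r //.
  by rewrite add0r.
split=> x xq.
  suff [->//] : (x, 0) = 0 :> qcar (psum q r).
  by apply: ns => -[u v]; rewrite polar_psum /= xq polar0l // addr0.
suff [->//] : (0, x) = 0 :> qcar (psum q r).
by apply: ns => -[u v]; rewrite polar_psum /= xq polar0l // addr0.
Qed.

Lemma polar_pf n (a b : 'I_n -> F) x y : polar (pf a b) x y =
  \sum_i (x.1 0 i * y.2 0 i + y.1 0 i * x.2 0 i).
Proof.
by rewrite polar_pf_val; apply: eq_bigr => i _; rewrite char2; ring.
Qed.

Lemma nonsing_pf n (a b : 'I_n -> F) : nonsing (pf a b).
Proof.
move=> [x y] xy; congr (_, _); apply/rowP => i; rewrite mxE.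
  have := xy (0, delta_mx 0 i); rewrite polar_pf (bigD1 i) //= !mxE !eqxx.
  rewrite mulr1 mul0r addr0 big1 ?addr0 // => j ji.
  by rewrite !mxE eqxx (negPf ji) mulr0 mul0r addr0.
have := xy (delta_mx 0 i, 0); rewrite polar_pf (bigD1 i) //= !mxE !eqxx.
rewrite mul1r mulr0 add0r big1 ?addr0 // => j ji.
by rewrite !mxE eqxx (negPf ji) mulr0 mul0r addr0.
Qed.

Lemma nonsing_tf m (c : 'I_m -> F) : nonsing (tf c) -> m = 0%N.
Proof.
case: m c => // m c ns; have /rowP/(_ 0) : const_mx 1 = 0 :> 'rV[F]_m.+1.
  apply: ns => y; rewrite polar_tf_val big1 // => i _.
  by rewrite char2 !mul0r.
by rewrite !mxE => /eqP; rewrite oner_eq0.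
Qed.

(* [a, b] _|_ [a, b] is the sum of two hyperbolic planes: with X = x + x' and
   Y = y + y', the form is X (a X + y') + Y (b Y + x). *)
Lemma pf_double n (a b : 'I_n -> F) : weq (psum (pf a b) (pf a b)) (Zf F 0 0).
Proof.
have addxx (V : lmodType F) (x : V) : x + x = 0.
  by rewrite -mulr2n -scaler_nat char2 scale0r.
pose z : 'I_n -> F := fun => 0.
have : iso (psum (pf a b) (pf a b)) (psum (pf z z) (pf z z)).
  pose D (c : 'I_n -> F) (x : 'rV[F]_n) := \row_i (c i * x 0 i).
  apply: (@isoI _ (psum (pf _ _) (pf _ _)) (psum (pf _ _) (pf _ _))
   (fun v => let X := v.1.1 + v.2.1 in let Y := v.1.2 + v.2.2 in
      ((X, v.2.2 + D a X), (Y, v.1.1 + D b Y)))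
   (fun v => let x := v.2.2 + D b v.2.1 in let y' := v.1.2 + D a v.1.1 in
      ((x, y' + v.2.1), (x + v.1.1, y')))).
  - move=> c [[x y] [x' y']] [[u v] [u' v']].
    by congr ((_, _), (_, _)); apply/rowP => i; rewrite !mxE; ring.
  - move=> [[x y] [x' y']] /=.
    have R1 (u v : 'rV[F]_n) : u + v + v = u by rewrite -addrA addxx addr0.
    by rewrite !R1 [y + y']addrC [y' + (y' + y)]addrA addxx add0r
      [x + (x + x')]addrA addxx add0r.
  - move=> [[x y] [x' y']] /=.
    have R1 (u v : 'rV[F]_n) : u + v + v = u by rewrite -addrA addxx addr0.
    have R2 (u v : 'rV[F]_n) : u + (u + v) = v by rewrite addrA addxx add0r.
    by rewrite R2 [y + _ + x' + _]addrAC addxx add0r !R1.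
  - move=> [[x y] [x' y']] /=; rewrite /pf_val -!big_split /=.
    (* An identity special to characteristic 2 is reduced to a general ring identity by exhibiting
       the difference of its sides as twice an explicit term. *)
    have E (s t u : F) : s = t + 2 * u -> s = t.
      by rewrite char2 mul0r addr0.
    apply: eq_bigr => i _; rewrite !mxE /z.
    apply: (E _ _ (a i * x 0 i * x' 0 i + b i * y 0 i * y' 0 i + x 0 i * y' 0 i)).
    by ring.
move=> ->; apply: weq_trans (_ : weq (psum (Zf F n 0) (Zf F n 0)) _).
  apply: weq_psum; apply: iso_weq; symmetry; apply: psum_null => u; exact: rV0.
by rewrite weq_Zf -(psumZ00 (Zf F n 0)) psumC weq_Zf.
Qed.

End Decomposition.

(** * Scaling forms and rescaling symplectic pairs *)

Section Scaling.
Variable F : fieldType.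
Implicit Types V W : qspace F.

Lemma sc_quadratic (a : F) V : is_quadratic (fun x => a * V x).
Proof.
have VP := qfunP V; split=> [c x|x c y z]; first by rewrite quadZ // mulrCA.
by rewrite /polar -!mulrBr -![V _ - _ - _]/(polar V _ _) polarPr //; ring.
Qed.

Definition sc a V : qspace F := QSpace (sc_quadratic a V).

Lemma polar_sc a V x y : polar (sc a V) x y = a * polar V x y.
Proof. by rewrite /polar /= -!mulrBr. Qed.

Lemma sc_iso a V W : iso V W -> iso (sc a V) (sc a W).
Proof.
by move=> [f [g [fK gK fq]]]; exists f, g; split=> // x; rewrite /= fq.
Qed.

Lemma sc_psum a V W : iso (sc a (psum V W)) (psum (sc a V) (sc a W)).
Proof. by apply: iso_eq => x; rewrite /= mulrDr. Qed.

Lemma sc1 V : iso (sc 1 V) V.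
Proof.
by apply: (@isoI _ (sc 1 V) V id id) => // x; rewrite /= mul1r.
Qed.

Lemma sc_sqr a V : a != 0 -> iso (sc (a ^+ 2) V) V.
Proof.
move=> a0; apply: (@isoI _ (sc (a ^+ 2) V) V ( *:%R a) ( *:%R a^-1)).
- by move=> b x y; rewrite scalerDr !scalerA mulrC.
- by move=> x; rewrite scalerA mulVf ?scale1r.
- by move=> x; rewrite scalerA divff ?scale1r.
- by move=> x; rewrite (quadZ (qfunP V)).
Qed.

(** The coordinates change by w_i but the coefficients only by w_i^2: with w_i in K, the coordinates
    can be normalised while the coefficients stay in F. *)
Lemma pf_scale n (a b w : 'I_n -> F) (x : 'rV[F]_n * 'rV[F]_n) :
  (forall i, w i != 0) ->
  pf_val (fun i => a i * w i ^+ 2) (fun i => b i / w i ^+ 2)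
    (\row_i (x.1 0 i / w i), \row_i (x.2 0 i * w i)) = pf_val a b x.
Proof.
move=> w0; apply: eq_bigr => i _; rewrite !mxE.
by field; exact: w0.
Qed.

Lemma row_mulKf n (w : 'I_n -> F) (x : 'rV[F]_n) : (forall i, w i != 0) ->
  \row_i ((\row_j (x 0 j / w j)) 0 i * w i) = x.
Proof. by move=> w0; apply/rowP => i; rewrite !mxE mulfVK. Qed.

Lemma row_mulfK n (w : 'I_n -> F) (x : 'rV[F]_n) : (forall i, w i != 0) ->
  \row_i ((\row_j (x 0 j * w j)) 0 i / w i) = x.
Proof. by move=> w0; apply/rowP => i; rewrite !mxE mulfK. Qed.

Lemma pf_scale_iso n (a b w : 'I_n -> F) : (forall i, w i != 0) ->
  iso (pf a b) (pf (fun i => a i * w i ^+ 2) (fun i => b i / w i ^+ 2)).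
Proof.
move=> w0; apply: (@isoI _ (pf _ _) (pf _ _)
  (fun x => (\row_i (x.1 0 i / w i), \row_i (x.2 0 i * w i)))
  (fun x => (\row_i (x.1 0 i * w i), \row_i (x.2 0 i / w i)))).
- by move=> c x y; congr (_, _); apply/rowP => i; rewrite !mxE /=; ring.
- by move=> [x y] /=; rewrite row_mulKf ?row_mulfK.
- by move=> [x y] /=; rewrite row_mulKf ?row_mulfK.
- by move=> x; exact: pf_scale.
Qed.

Lemma tf_scale_iso n (c w : 'I_n -> F) : (forall i, w i != 0) ->
  iso (tf c) (tf (fun i => c i * w i ^+ 2)).
Proof.
move=> w0; apply: (@isoI _ (tf _) (tf _)
  (fun x => \row_i (x 0 i / w i)) (fun x => \row_i (x 0 i * w i))).
- by move=> d x y; apply/rowP => i; rewrite !mxE /=; ring.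
- by move=> x; rewrite row_mulKf.
- by move=> x; rewrite row_mulfK.
- by move=> x; apply: eq_bigr => i _; rewrite !mxE; field; exact: w0.
Qed.

(** Only the second coordinates are rescaled, by [t] itself. When t = w^2 in K, the rescaling of
    pairs by w over K therefore amounts over F to multiplication by [t]. *)
Lemma sc_pf n (a b : 'I_n -> F) t : t != 0 ->
  iso (sc t (pf a b)) (pf (fun i => a i * t) (fun i => b i / t)).
Proof.
move=> t0; apply: (@isoI _ (sc t (pf a b)) (pf _ _)
  (fun x => (x.1, t *: x.2)) (fun x => (x.1, t^-1 *: x.2))).
- move=> c x y; congr (_, _); rewrite /= scalerDr !scalerA; congr (_ *: _ + _).
  by rewrite mulrC.
- by move=> [x y] /=; rewrite scalerA mulVf // scale1r.
- by move=> [x y] /=; rewrite scalerA divff // scale1r.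
- move=> x; rewrite /= /pf_val mulr_sumr; apply: eq_bigr => i _.
  by rewrite !mxE; field.
Qed.

Lemma pf_eq n (a b a' b' : 'I_n -> F) : a =1 a' -> b =1 b' ->
  iso (pf a b) (pf a' b').
Proof.
by move=> Ea Eb; apply: iso_eq => x; apply: eq_bigr => i _; rewrite Ea Eb.
Qed.

Lemma tf_eq n (c c' : 'I_n -> F) : c =1 c' -> iso (tf c) (tf c').
Proof.
by move=> Ec; apply: iso_eq => x; apply: eq_bigr => i _; rewrite Ec.
Qed.

Lemma sc_Zf k m t : t != 0 -> iso (sc t (Zf F k m)) (Zf F k m).
Proof.
move=> t0; rewrite /Zf sc_psum; apply: psum_iso.
  by rewrite sc_pf //; apply: pf_eq => i; rewrite mul0r.
apply: iso_eq => x; rewrite /= /tf_val mulr_sumr; apply: eq_bigr => i _.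
by rewrite !mul0r mulr0.
Qed.

Lemma sc_weq t V W : t != 0 -> weq V W -> weq (sc t V) (sc t W).
Proof.
move=> t0 [k [m [k' [m' H]]]]; exists k, m, k', m'.
by have := sc_iso t H; rewrite (sc_psum t V) (sc_psum t W) !sc_Zf.
Qed.

Lemma nonsing_sc t V : t != 0 -> nonsing V -> nonsing (sc t V).
Proof.
move=> t0 ns x xV; apply: ns => y; have /eqP := xV y.
by rewrite polar_sc mulf_eq0 (negPf t0) => /eqP.
Qed.

Lemma qscale_iso a (q : qform F) : iso (qscale a q) (sc a q).
Proof. exact: iso_eq. Qed.

Lemma diag_tensor_iso t (q : qform F) :
  iso (diag_tensor [:: 1; t] q) (psum q (sc t q)).
Proof.
rewrite /diag_tensor big_cons big_cons big_nil !perp_psum !qscale_iso.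
apply: psum_iso; first exact: sc1.
by apply: psum_null => x; exact: rV0.
Qed.

Lemma nonsing_pf_iso (q : qform F) : 2 = 0 :> F -> nonsing q ->
  exists n (a b : 'I_n -> F), iso q (pf a b).
Proof.
move=> char2 ns; have [n [m [a [b [c H]]]]] := decomp char2 q.
have /nonsing_psum[_ /(nonsing_tf char2) m0] := nonsing_iso H ns.
exists n, a, b; rewrite H; apply: psum_null.
by rewrite /= m0 => x; exact: rV0.
Qed.

End Scaling.

(** * Scalar extension *)

Section Expansion.
Variables (F : fieldType) (V : lmodType F) (q : V -> F).
Hypothesis qP : is_quadratic q.

Lemma polar_suml n (v : 'I_n -> V) u :
  polar q (\sum_i v i) u = \sum_i polar q (v i) u.
Proof.
apply: (big_morph (fun x => polar q x u)) => [x y|]; last exact: polar0l.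
exact: polarDl.
Qed.

Lemma quad_sum n (v : 'I_n -> V) : q (\sum_i v i) =
  \sum_i q (v i) + \sum_(i < n) \sum_(j < n | (i < j)%N) polar q (v i) (v j).
Proof.
elim: n v => [|n IH] v; first by rewrite !big_ord0 quad0 ?addr0.
rewrite !big_ord_recr /= quadD IH polar_suml.
rewrite [X in _ = _ + (_ + X)]big1; last first.
  by move=> j; rewrite ltnNge -ltnS ltn_ord.
rewrite addr0 -!addrA; congr (_ + _).
rewrite addrCA; congr (_ + _); rewrite -big_split; apply: eq_bigr => i _ /=.
rewrite [in RHS]big_mkcond big_ord_recr /= ltn_ord; congr (_ + _).
by rewrite -big_mkcond.
Qed.

End Expansion.

Lemma quad_expand (F : fieldType) n (q : 'rV[F]_n -> F) (x : 'rV[F]_n) :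
  is_quadratic q ->
  q x = \sum_i q (delta_mx 0 i) * x 0 i ^+ 2 +
  \sum_(i < n) \sum_(j < n | (i < j)%N)
    polar q (delta_mx 0 i) (delta_mx 0 j) * (x 0 i * x 0 j).
Proof.
move=> qP; rewrite {1}(row_sum_delta x) quad_sum //; congr (_ + _).
  by apply: eq_bigr => i _; rewrite quadZ // mulrC.
apply: eq_bigr => i _; apply: eq_bigr => j _.
by rewrite polarZl // polarZr //; ring.
Qed.

Section Extension.
Variables (F K : fieldType) (iota : {rmorphism F -> K}).
Implicit Types q r : qform F.
Local Notation "q ^K" := (qext iota q) (at level 2).

Lemma qext_map q x : q^K (map_mx iota x) = iota (q x).
Proof.
change (ext_val iota (map_mx iota x) = iota (@qval _ q x)).
rewrite (quad_expand x (qvalP q)) rmorphD !rmorph_sum /= /ext_val.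
congr (_ + _); apply: eq_bigr => i _; first by rewrite rmorphM rmorphXn mxE.
by rewrite rmorph_sum; apply: eq_bigr => j _; rewrite !rmorphM !mxE.
Qed.

(** A quadratic form is determined by its values on basis vectors and on their sums, all of which
    are F-rational. Each identification of an extended form below reduces to this. *)
Lemma qext_unique q (Q : 'rV[K]_(qdim q) -> K) : is_quadratic Q ->
  (forall x, Q (map_mx iota x) = iota (q x)) -> Q =1 q^K.
Proof.
move=> QP QE x; rewrite (quad_expand x QP) /= /ext_val.
have D i : delta_mx 0 i = map_mx iota (delta_mx 0 i) :> 'rV[K]_(qdim q).
  by rewrite map_delta_mx.
congr (_ + _); apply: eq_bigr => i _; first by rewrite D QE.
apply: eq_bigr => j _; congr (_ * _).
by rewrite /polar !D -map_mxD !QE !rmorphB.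
Qed.

Lemma qext_iso_val q (Q : 'rV[K]_(qdim q) -> K) (QP : is_quadratic Q) :
  (forall x, Q (map_mx iota x) = iota (q x)) -> iso q^K (QSpace QP).
Proof. by move=> H; apply: iso_eq => x; rewrite (qext_unique QP H). Qed.

Lemma iso_qext q r : iso q r -> iso q^K r^K.
Proof.
move=> [f [g [fK gK fq]]].
have gP : linear g by move=> a x y; apply: (can_inj fK); rewrite linearP !gK.
pose M := lin1_mx f; pose N := lin1_mx (lin gP).
have MN : M *m N = 1%:M.
  apply/row_matrixP => i; rewrite row_mul row1 !rowE.
  by rewrite !mul_rV_lin1 /= fK.
have NM : N *m M = 1%:M.
  apply/row_matrixP => i; rewrite row_mul row1 !rowE.
  by rewrite !mul_rV_lin1 /= gK.
apply: (@isoI _ q^K r^K (mulmxr (map_mx iota M)) (mulmxr (map_mx iota N))).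
- exact: linearP.
- by move=> x /=; rewrite -mulmxA -map_mxM MN map_mx1 mulmx1.
- by move=> x /=; rewrite -mulmxA -map_mxM NM map_mx1 mulmx1.
have QP := quad_comp (qvalP r^K) (mulmxr (map_mx iota M)).
apply: (qext_unique QP) => x; rewrite /= -map_mxM mul_rV_lin1.
by rewrite [LHS]qext_map; congr (iota _); exact: fq.
Qed.

Lemma qext_perp q r : iso (perp q r)^K (psum q^K r^K).
Proof.
rewrite -perp_psum; apply: (@qext_iso_val (perp q r)) => x.
by rewrite /= -map_lsubmx -map_rsubmx rmorphD; congr (_ + _); exact: qext_map.
Qed.

Lemma qext_sc t q : iso (qscale t q)^K (sc (iota t) q^K).
Proof.
apply: (@qext_iso_val (qscale t q)) => x.
by rewrite /= rmorphM; congr (_ * _); exact: qext_map.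
Qed.

Lemma qext_pfq n (a b : 'I_n -> F) :
  iso (pfq a b)^K (pf (iota \o a) (iota \o b)).
Proof.
rewrite -pfq_iso; apply: (@qext_iso_val (pfq a b)) => x.
rewrite /= /pf_val rmorph_sum; apply: eq_bigr => i _ /=.
by rewrite !mxE !rmorphD !rmorphM.
Qed.

Lemma qext_tfq n (c : 'I_n -> F) : iso (tfq c)^K (tf (iota \o c)).
Proof.
apply: (@qext_iso_val (tfq c)) => x.
rewrite /= /tf_val rmorph_sum; apply: eq_bigr => i _ /=.
by rewrite !mxE !rmorphM.
Qed.

Definition Zq k m : qform F :=
  perp (pfq (fun _ : 'I_k => 0) (fun => 0)) (tfq (fun _ : 'I_m => 0)).

Lemma Zq_iso k m : iso (Zq k m) (Zf F k m).
Proof. by rewrite perp_psum pfq_iso. Qed.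

Lemma qext_Zq k m : iso (Zq k m)^K (Zf K k m).
Proof.
rewrite qext_perp qext_pfq qext_tfq; apply: psum_iso.
  by apply: pf_eq => i /=; rewrite rmorph0.
by apply: tf_eq => i /=; rewrite rmorph0.
Qed.

Lemma weq_qext q r : weq q r -> weq q^K r^K.
Proof.
move=> [k [m [k' [m' H]]]]; exists k, m, k', m'.
have : iso (perp q (Zq k m)) (perp r (Zq k' m')) 
    by rewrite (perp_psum q) (perp_psum r) !Zq_iso.
by move/iso_qext; rewrite (qext_perp q) (qext_perp r) !qext_Zq.
Qed.

Hypothesis charF : 2 = 0 :> F.

Lemma char2K : 2 = 0 :> K.
Proof. by rewrite -(rmorph_nat iota) charF rmorph0. Qed.

(** A nonsingular form is a sum of planes [a, b], and this shape persists over K, where it is again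
    nonsingular. *)
Lemma nonsing_qext q : nonsing q -> nonsing q^K.
Proof.
move=> ns; have [n [a [b H]]] := nonsing_pf_iso charF ns.
have : iso q (pfq a b) by rewrite pfq_iso.
move/iso_qext; rewrite qext_pfq => /iso_sym/nonsing_iso; apply.
exact: nonsing_pf char2K _ _ _.
Qed.

End Extension.

Lemma sum_delta (R : pzRingType) n (i0 : 'I_n) (f : 'I_n -> R) :
  \sum_i (i == i0)%:R * f i = f i0.
Proof.
rewrite (bigD1 i0) //= eqxx mul1r big1 ?addr0 // => i /negPf ->.
exact: mul0r.
Qed.

(** * The symplectic change of basis *)

Section BaseChange.
Variables (F : fieldType) (n : nat) (i0 : 'I_n) (chi : 'I_n -> F) (s : F).
Hypotheses (char2 : 2 = 0 :> F) (chi0 : chi i0 = 0).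

Definition dot (y : 'rV[F]_n) : F := \sum_i chi i * y 0 i.

Lemma dotD y z : dot (y + z) = dot y + dot z.
Proof.
by rewrite /dot -big_split; apply: eq_bigr => i _; rewrite mxE mulrDr.
Qed.

Lemma dotZ a y : dot (a *: y) = a * dot y.
Proof. by rewrite /dot mulr_sumr; apply: eq_bigr => i _; rewrite mxE mulrCA. Qed.

Lemma dot_delta a : dot (a *: delta_mx 0 i0) = 0.
Proof.
rewrite dotZ /dot (bigD1 i0) //= chi0 mul0r add0r big1 ?mulr0 // => i ii0.
by rewrite !mxE (negPf ii0) mulr0.
Qed.

(* The basis change e_i0 |-> e_i0 + sum_j chi_j e_j + s f_i0 and
   f_j |-> f_j - chi_j f_i0, in coordinates. *)
Definition bc_vec (v : 'rV[F]_n * 'rV[F]_n) : 'rV[F]_n * 'rV[F]_n :=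
  (v.1 + v.1 0 i0 *: \row_i chi i,
   v.2 + (s * v.1 0 i0 - dot v.2) *: delta_mx 0 i0).

Definition bc_inv (v : 'rV[F]_n * 'rV[F]_n) : 'rV[F]_n * 'rV[F]_n :=
  (v.1 - v.1 0 i0 *: \row_i chi i,
   v.2 - (s * v.1 0 i0 - dot v.2) *: delta_mx 0 i0).

Variables a b : 'I_n -> F.

(** [bc_a] and [bc_b] are the values of the form on the new basis vectors; the lone term [s] is the
    pairing of e_i0 with s f_i0. *)
Definition bc_a (i : 'I_n) : F :=
  a i + (i == i0)%:R * (\sum_j a j * chi j ^+ 2 + s + b i0 * s ^+ 2).

Definition bc_b (i : 'I_n) : F := b i + b i0 * chi i ^+ 2.

(** Additivity of squaring turns the square of [dot] into a diagonal form, so no cross terms between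
    the f_j appear after the change of basis. *)
Lemma sqr_sum2 (f : 'I_n -> F) : (\sum_i f i) ^+ 2 = \sum_i f i ^+ 2.
Proof.
apply: (big_morph (fun x => x ^+ 2)) => [x y|]; last by rewrite expr0n.
have -> : (x + y) ^+ 2 = x ^+ 2 + y ^+ 2 + 2 * (x * y) by ring.
by rewrite char2 mul0r addr0.
Qed.

Lemma bc_val v : pf_val a b (bc_vec v) = pf_val bc_a bc_b v.
Proof.
case: v => x y; rewrite /bc_vec /=.
set d := s * x 0 i0 - dot y.
have E (p q r : F) : p = q + 2 * r -> p = q by rewrite char2 mul0r addr0.
have L : pf_val a b (x + x 0 i0 *: \row_i chi i, y + d *: delta_mx 0 i0) =
    pf_val a b (x, y) + x 0 i0 ^+ 2 * (\sum_i a i * chi i ^+ 2)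
    + x 0 i0 * dot y + d * (\sum_i (i == i0)%:R * (x 0 i + x 0 i0 * chi i))
    + d ^+ 2 * (\sum_i (i == i0)%:R * b i).
  rewrite /pf_val /dot !mulr_sumr -!big_split; apply: eq_bigr => i _ /=.
  rewrite !mxE eqxx /=; case: (i == i0).
    by apply: (E _ _ (a i * x 0 i * x 0 i0 * chi i + b i * y 0 i * d));
      rewrite /= mulr1n; ring.
  by apply: (E _ _ (a i * x 0 i * x 0 i0 * chi i)); rewrite /= mulr0n; ring.
have R : pf_val bc_a bc_b (x, y) = pf_val a b (x, y)
    + (\sum_j a j * chi j ^+ 2 + s + b i0 * s ^+ 2) *
      (\sum_i (i == i0)%:R * x 0 i ^+ 2)
    + b i0 * \sum_i (chi i * y 0 i) ^+ 2.
  rewrite /pf_val !mulr_sumr -!big_split; apply: eq_bigr => i _ /=.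
  by rewrite /bc_a /bc_b; ring.
rewrite L R !sum_delta chi0 mulr0 addr0 -sqr_sum2 -/(dot y) /d.
by apply: (E _ _ (- b i0 * s * x 0 i0 * dot y)); ring.
Qed.

Lemma bc_iso : iso (pf bc_a bc_b) (pf a b).
Proof.
apply: (@isoI _ (pf bc_a bc_b) (pf a b) bc_vec bc_inv) => [c [x y] [x' y']|||].
- rewrite /bc_vec /= !mxE dotD dotZ.
  by congr (_, _); apply/rowP => i; rewrite !mxE; ring.
- move=> [x y]; rewrite /bc_vec /bc_inv /= dotD dot_delta addr0 !mxE chi0 mulr0.
  by rewrite addr0 !addrK.
- have dotN z : dot (- z) = - dot z by rewrite -scaleN1r dotZ mulN1r.
  move=> [x y]; rewrite /bc_vec /bc_inv /= dotD dotN dot_delta subr0.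
  by rewrite !mxE chi0 mulr0 subr0 !subrK.
- exact: bc_val.
Qed.

End BaseChange.

(** * Descent to a form over F that is anisotropic over K *)

Section Kernel.
Variables (F K : fieldType) (iota : {rmorphism F -> K}).
Hypothesis charF : 2 = 0 :> F.
Implicit Types q r S : qform F.
Local Notation "q ^K" := (qext iota q) (at level 2).
Local Notation square := (nonzero_squares iota).

Lemma square_neq0 t : square t -> t != 0.
Proof.
move=> [x x0 tx]; apply: contraNneq x0 => t0.
by move: tx; rewrite t0 rmorph0 => /esym/eqP; rewrite sqrf_eq0.
Qed.

(** Explicit representatives for the right-hand side of (ii), which allow the descent to work with
    forms instead of sets of classes. *)
Inductive kernel_gen : qform F -> Prop :=
| kernel_gen0 : kernel_gen (qzero F 0)
| kernel_genS t r S : square t -> nonsing r -> kernel_gen S ->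
    kernel_gen (perp (diag_tensor [:: 1; t] r) S).

Lemma kernel_gen_perp S S' : kernel_gen S -> kernel_gen S' ->
  exists2 S'', kernel_gen S'' & iso S'' (psum S S').
Proof.
move=> gS gS'; elim: gS => [|t r S1 sqt nr gS1 [S'' gS'' H]].
  exists S' => //; rewrite psumC psum_null // => x; exact: rV0.
exists (perp (diag_tensor [:: 1; t] r) S''); first exact: kernel_genS.
by rewrite (perp_psum _ S'') H psumA (perp_psum _ S1).
Qed.

Lemma nonsing_qzero : nonsing (qzero F 0).
Proof. by move=> x _; exact: rV0. Qed.

Lemma nonsing_diag t r : square t -> nonsing r ->
  nonsing (diag_tensor [:: 1; t] r).
Proof.
move=> sqt nr; apply: nonsing_iso (iso_sym (diag_tensor_iso t r)) _.
apply/nonsing_psum; split=> //; apply: nonsing_sc => //; exact: square_neq0.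
Qed.

Lemma kernel_gen_nonsing S : kernel_gen S -> nonsing S.
Proof.
elim=> [|t r S1 sqt nr _ nS1]; first exact: nonsing_qzero.
apply: nonsing_iso (iso_sym (perp_psum _ _)) _.
by apply/nonsing_psum; split=> //; exact: nonsing_diag.
Qed.

Lemma qzero_Zf (L : fieldType) : iso (qzero L 0) (Zf L 0 0).
Proof. by apply: null_iso; [exact: rV0|exact: Zf00_null]. Qed.

(** Over K the factor [t] is a square, so the form becomes r _|_ r, which is hyperbolic in
    characteristic 2. *)
Lemma qext_diag_tensor t r : square t -> nonsing r ->
  weq (diag_tensor [:: 1; t] r)^K (Zf K 0 0).
Proof.
move=> [x x0 tx] nr.
have : iso (diag_tensor [:: 1; t] r) (perp r (qscale t r)).
  by rewrite diag_tensor_iso perp_psum qscale_iso.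
move/(iso_qext iota) => ->; rewrite qext_perp qext_sc tx sc_sqr //.
have c2 := char2K iota charF.
have [n [a [b ->]]] := nonsing_pf_iso c2 (nonsing_qext (iota := iota) charF nr).
exact: pf_double.
Qed.

Lemma kernel_gen_qext S : kernel_gen S -> weq S^K (Zf K 0 0).
Proof.
elim=> [|t r S1 sqt nr _ IH].
  by apply: iso_weq; apply: null_iso; [exact: rV0|exact: Zf00_null].
by rewrite qext_perp IH qext_diag_tensor // weq_Zf.
Qed.

(** One relation serves both parts: the first clause, for arbitrary forms, keeps the class over K
    for (i); the second records, for nonsingular forms, the change of class over F for (ii). *)
Definition descends q r : Prop :=
  weq q^K r^K /\
  (nonsing q -> nonsing r /\ exists2 S, kernel_gen S & weq q (psum r S)).

Lemma descends_weq q r : weq q r -> (nonsing q -> nonsing r) -> descends q r.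
Proof.
move=> H ns; split=> [|nq]; first exact: weq_qext.
split; first exact: ns.
by exists (qzero F 0); [exact: kernel_gen0|rewrite qzero_Zf psumZ00].
Qed.

Lemma descends_iso q r : iso q r -> descends q r.
Proof.
by move=> H; apply: descends_weq; [exact: iso_weq|exact: nonsing_iso].
Qed.

Lemma descends_trans q r s : descends q r -> descends r s -> descends q s.
Proof.
move=> [H1 H2] [H3 H4]; split=> [|nq]; first exact: weq_trans H3.
have [nr [S gS HS]] := H2 nq; have [ns [S' gS' HS']] := H4 nr.
split=> //; have [S'' gS'' E] := kernel_gen_perp gS' gS.
by exists S'' => //; rewrite HS HS' E psumA.
Qed.

Definition nfq n m (a b : 'I_n -> F) (c : 'I_m -> F) : qform F :=
  perp (pfq a b) (tfq c).

Lemma nfq_iso n m (a b : 'I_n -> F) (c : 'I_m -> F) :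
  iso (nfq a b c) (psum (pf a b) (tf c)).
Proof. by rewrite perp_psum pfq_iso. Qed.

Lemma qext_nfq n m (a b : 'I_n -> F) (c : 'I_m -> F) :
  iso (nfq a b c)^K (psum (pf (iota \o a) (iota \o b)) (tf (iota \o c))).
Proof. by rewrite qext_perp qext_pfq qext_tfq. Qed.

(** Each pair contributes one generator <1, t_i>_b (x) [a_i, b_i], by [sc_pf]. *)
Lemma kernel_gen_pf n (a b t : 'I_n -> F) : (forall i, square (t i)) ->
  exists2 S, kernel_gen S &
    iso (psum (pf a b) (pf (fun i => a i * t i) (fun i => b i / t i))) S.
Proof.
elim: n a b t => [|n IH] a b t sqt.
  exists (qzero F 0); first exact: kernel_gen0.
  by apply: null_iso => [[[x y] [x' y']]|x]; rewrite ?(rV0 x) ?(rV0 y) ?(rV0 x')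
    ?(rV0 y').
have [S gS H] := IH (a \o @rshift 1 n) (b \o @rshift 1 n) (t \o @rshift 1 n)
  (fun i => sqt _).
have t00 := square_neq0 (sqt (lshift n (0 : 'I_1))).
set t0 := t _ in t00.
exists (perp (diag_tensor [:: 1; t0]
    (pfq (a \o @lshift 1 n) (b \o @lshift 1 n))) S).
  apply: kernel_genS gS; first exact: sqt.
  apply: nonsing_iso (iso_sym (pfq_iso _ _)) _; exact: nonsing_pf.
rewrite perp_psum diag_tensor_iso -H -[n.+1]/(1 + n)%N.
rewrite (@pf_add _ 1 n a b) (@pf_add _ 1 n (fun i => _)) psumACA.
apply: psum_iso; last exact: iso_refl.
rewrite (sc_iso _ (pfq_iso _ _)) (sc_pf _ _ t00).
apply: psum_iso; first by rewrite pfq_iso.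
by apply: pf_eq => i; rewrite /= (ord1 i).
Qed.

Lemma descends_pf_scale n m (a b t : 'I_n -> F) (c : 'I_m -> F) (w : 'I_n -> K) :
  (forall i, w i != 0) -> (forall i, iota (t i) = w i ^+ 2) ->
  descends (nfq a b c) (nfq (fun i => a i * t i) (fun i => b i / t i) c).
Proof.
move=> w0 tw.
have sqt i : square (t i) by exists (w i).
split.
  apply: iso_weq; rewrite !qext_nfq; apply: psum_iso => //.
  rewrite (pf_scale_iso _ _ w0); apply: pf_eq => i /=.
    by rewrite rmorphM tw.
  by rewrite fmorph_div tw.
move/(nonsing_iso (nfq_iso _ _ _))/nonsing_psum => [_ nc].
split.
  apply: nonsing_iso (iso_sym (nfq_iso _ _ _)) _; apply/nonsing_psum; split=> //.
  exact: nonsing_pf.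
have [S gS H] := kernel_gen_pf a b sqt; exists S => //.
rewrite -H !nfq_iso; symmetry.
set P' := pf _ (fun i => b i / t i).
(* P is recovered as P' + (P + P'), since P' + P' is trivial. *)
by rewrite (psumC (pf a b)) psumACA pf_double // psumC psumZ00 psumC.
Qed.

(** Over K the diagonal part changes by squares only. Over F its class may really change, but a
    nonsingular form has no diagonal part, so nothing has to be recorded there. *)
Lemma descends_tf_scale n m (a b : 'I_n -> F) (c u : 'I_m -> F) (w : 'I_m -> K) :
  (forall i, w i != 0) -> (forall i, iota (u i) = w i ^+ 2) ->
  descends (nfq a b c) (nfq a b (fun i => c i * u i)).
Proof.
move=> w0 tw.
have [m0|m0] := eqVneq m 0%N.
  apply: descends_iso; rewrite !nfq_iso; apply: psum_iso => //; apply: tf_eq => i.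
  by case: i => i hi; have := hi; rewrite {1}m0.
split.
  apply: iso_weq; rewrite !qext_nfq; apply: psum_iso => //.
  rewrite (tf_scale_iso _ w0); apply: tf_eq => i /=.
  by rewrite rmorphM tw.
move/(nonsing_iso (nfq_iso _ _ _))/nonsing_psum => [_ /(nonsing_tf charF) mE].
by rewrite mE eqxx in m0.
Qed.

Definition nfK n m (a b : 'I_n -> F) (c : 'I_m -> F) (x y : 'rV[K]_n)
    (z : 'rV[K]_m) : K :=
  pf_val (iota \o a) (iota \o b) (x, y) + tf_val (iota \o c) z.

Hypothesis K2F : forall x : K, exists a : F, iota a = x ^+ 2.

Lemma sqrF_choice n (w : 'I_n -> K) :
  exists t : 'I_n -> F, forall i, iota (t i) = w i ^+ 2.
Proof.
have [t tE] := @boolp.choice _ _ (fun i d => iota d = w i ^+ 2) (fun i => K2F (w i)).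
by exists t.
Qed.

(** Normalising y_i to 1 alters x_i by the inverse factor, which is harmless because x_i = 0
    whenever y_i is nonzero. *)
Lemma isotropic_descent_axis n m (a b : 'I_n -> F) (c : 'I_m -> F)
    (x y : 'rV[K]_n) (z : 'rV[K]_m)
    (xi : 'I_n -> F) :
  (forall i, x 0 i = iota (xi i)) -> (forall i, x 0 i = 0 \/ y 0 i = 0) ->
  [|| x != 0, y != 0 | z != 0] -> nfK a b c x y z = 0 ->
  exists a' b' c', descends (nfq a b c) (@nfq n m a' b' c') /\
    exists2 v, v != 0 & @nfq n m a' b' c' v = 0.
Proof.
move=> xE xy nz nf0.
(* Rescaling multiplies y_i by w_i but divides z_i by u_i, hence the inverse in one case only. The
   default 1 keeps the factors nonzero. *)
pose w i := if y 0 i == 0 then 1 else (y 0 i)^-1.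
pose u i := if z 0 i == 0 then 1 else z 0 i.
have w0 i : w i != 0.
  by rewrite /w; case: (eqVneq (y 0 i)) => h; rewrite ?oner_eq0 ?invr_eq0.
have u0 i : u i != 0 by rewrite /u; case: (eqVneq (z 0 i)) => h; rewrite ?oner_eq0.
have [t tE] := sqrF_choice w; have [r rE] := sqrF_choice u.
pose a' i := a i * t i; pose b' i := b i / t i; pose c' i := c i * r i.
exists a', b', c'; split.
  apply: descends_trans (descends_pf_scale _ _ _ w0 tE) (descends_tf_scale _ _ _ u0 rE).
pose eps (d : K) : F := (d != 0)%:R.
have epsE d : iota (eps d) = (d != 0)%:R by rewrite rmorph_nat.
pose X : 'rV[F]_n := \row_i xi i.
pose Y : 'rV[F]_n := \row_i eps (y 0 i).
pose Z : 'rV[F]_m := \row_i eps (z 0 i).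
exists (row_mx (row_mx X Y) Z).
  apply: contraTneq nz; rewrite -row_mx0 => /eq_row_mx[].
  rewrite -row_mx0 => /eq_row_mx[/rowP X0 /rowP Y0] /rowP Z0.
  rewrite !negb_or !negbK; apply/and3P; split; apply/eqP/rowP => i.
  - by rewrite xE; have := X0 i; rewrite !mxE => ->; rewrite rmorph0.
  - have := Y0 i; rewrite !mxE /eps; case: eqVneq => // _ /eqP.
    by rewrite oner_eq0.
  - have := Z0 i; rewrite !mxE /eps; case: eqVneq => // _ /eqP.
    by rewrite oner_eq0.
(* The value is computed in K, where the vector just built is the given one in rescaled
   coordinates. *)
apply: (fmorph_inj iota); rewrite rmorph0 -nf0.
rewrite /nfK -(pf_scale _ _ _ w0) /= !row_mxKl !row_mxKr rmorphD.
congr (_ + _).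
  rewrite /pf_val rmorph_sum; apply: eq_bigr => i _ /=.
  have xw : x 0 i / w i = iota (xi i).
    rewrite -xE /w; case: eqVneq => [_|y0]; first by rewrite divr1.
    by case: (xy i) y0 => [->|->]; rewrite ?mul0r ?eqxx.
  have yw : y 0 i * w i = iota (eps (y 0 i)).
    rewrite epsE /w; case: eqVneq => [->|y0]; first by rewrite mul0r.
    by rewrite divff.
  rewrite !mxE xw yw /a' /b' -tE.
  by rewrite !(rmorphD, rmorphM, rmorphXn, fmorphV).
rewrite /tf_val rmorph_sum; apply: eq_bigr => i _ /=.
rewrite !mxE /c' !(rmorphM, rmorphXn) /= rE epsE -mulrA; congr (_ * _).
rewrite /u; case: eqVneq => [->|z0]; first by rewrite expr1n !expr0n !mul1r.
by rewrite expr1n mulr1.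
Qed.

Lemma isotropic_descent n m (a b : 'I_n -> F) (c : 'I_m -> F)
    (x y : 'rV[K]_n) (z : 'rV[K]_m) :
  [|| x != 0, y != 0 | z != 0] -> nfK a b c x y z = 0 ->
  exists a' b' c', descends (nfq a b c) (@nfq n m a' b' c') /\
    exists2 v, v != 0 & @nfq n m a' b' c' v = 0.
Proof.
move=> nz nf0.
have [x0|] := eqVneq x 0.
  apply: (@isotropic_descent_axis _ _ _ _ _ x y z (fun => 0)) => // i.
    by rewrite x0 mxE rmorph0.
  by left; rewrite x0 mxE.
move/rV0Pn => [i0 xi0].
pose w i := if x 0 i == 0 then 1 else x 0 i.
have w0 i : w i != 0 by rewrite /w; case: (eqVneq (x 0 i)) => h; rewrite ?oner_eq0.
have [t tE] := sqrF_choice w.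
pose a1 i := a i * t i; pose b1 i := b i / t i.
have R1 : descends (nfq a b c) (nfq a1 b1 c) := descends_pf_scale a b c w0 tE.
pose x1 : 'rV[K]_n := \row_i (x 0 i / w i).
pose y1 : 'rV[K]_n := \row_i (y 0 i * w i).
have nf1 : nfK a1 b1 c x1 y1 z = 0.
  rewrite -nf0 /nfK -(pf_scale _ _ (x, y) w0); congr (_ + _).
  by apply: eq_bigr => i _; rewrite /= !mxE /a1 /b1 fmorph_div rmorphM tE.
(* Apart from the pivot [i0], this is the normalised first coordinate, now a 0/1 vector over F. *)
pose chi i : F := ((i != i0) && (x 0 i != 0))%:R.
have x1E i : x1 0 i = (i == i0)%:R + iota (chi i).
  rewrite mxE /w /chi rmorph_nat; case: (eqVneq i i0) => [->|_] /=.
    by rewrite (negPf xi0) divff // addr0.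
  by rewrite add0r; case: eqVneq => [->|h]; rewrite ?mul0r ?divff.
have chi0 : chi i0 = 0 by rewrite /chi eqxx.
(* This is the [s] forced by asking that the coordinate on f_i0 vanish in the new basis; it equals
   the sum of all x_i y_i. *)
pose e := y1 0 i0 + dot (iota \o chi) y1.
have xy1 : \sum_i x1 0 i * y1 0 i = e.
  rewrite /e -(sum_delta i0 (y1 0)) /dot -big_split; apply: eq_bigr => i _ /=.
  by rewrite x1E mulrDl.
(* By isotropy, e is a combination over F of squares of K. *)
have [s sE] : exists s, iota s = e.
  have [A AE] := sqrF_choice (x1 0); have [B BE] := sqrF_choice (y1 0).
  have [C CE] := sqrF_choice (z 0).
  exists (- (\sum_i (a1 i * A i + b1 i * B i) + \sum_i c i * C i)).
  apply/eqP; rewrite rmorphN eq_sym -addr_eq0; apply/eqP.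
  rewrite -xy1 -[RHS]nf1 rmorphD !rmorph_sum addrA -big_split /nfK; congr (_ + _).
    apply: eq_bigr => i _ /=.
    by rewrite rmorphD !rmorphM AE BE; ring.
  by apply: eq_bigr => i _ /=; rewrite rmorphM CE.
pose a2 := bc_a i0 chi s a1 b1; pose b2 := bc_b i0 chi b1.
have R2 : descends (nfq a1 b1 c) (nfq a2 b2 c).
  apply: descends_iso; rewrite !nfq_iso; apply: psum_iso => //; symmetry.
  exact: bc_iso.
pose x2 : 'rV[K]_n := delta_mx 0 i0.
(* Together with [x2], these are the coordinates of the same vector in the new basis. *)
pose y2 : 'rV[K]_n := y1 - y1 0 i0 *: delta_mx 0 i0.
have nf2 : nfK a2 b2 c x2 y2 z = 0.
  rewrite -nf1 /nfK; congr (_ + _).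
  have chi0K : (iota \o chi) i0 = 0 by rewrite /= chi0 rmorph0.
  have -> : (x1, y1) = bc_vec i0 (iota \o chi) (iota s) (x2, y2).
    rewrite /bc_vec /= /x2 mxE !eqxx scale1r mulr1; congr (_, _).
      by apply/rowP => i; rewrite x1E !mxE eqxx.
    rewrite /y2 dotD -scaleNr (dot_delta chi0K) addr0 sE /e addrK.
    by rewrite scaleNr subrK.
  rewrite (bc_val _ (char2K iota charF) chi0K); apply: eq_bigr => i _ /=.
  congr (_ * _ + _ + _ * _); rewrite /a2 /b2 /bc_a /bc_b /=.
    rewrite !(rmorphD, rmorphM, rmorphXn, rmorph_nat, rmorph_sum) /=.
    by congr (_ + _ * (_ + _ + _)); apply: eq_bigr => j _;
       rewrite rmorphM rmorphXn.
  by rewrite rmorphD rmorphM rmorphXn.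
have [|||a3 [b3 [c3 [R3 H]]]] :=
  isotropic_descent_axis (xi := fun i => (i == i0)%:R) _ _ _ nf2.
- by move=> i; rewrite mxE eqxx /= rmorph_nat.
- move=> i; rewrite /y2 !mxE eqxx /=; case: (eqVneq i i0) => [->|_].
    by right; rewrite mulr1 subrr.
  by left.
- apply/orP; left; apply/rV0Pn; exists i0; by rewrite mxE !eqxx oner_eq0.
exists a3, b3, c3; split=> //.
exact: descends_trans R1 (descends_trans R2 R3).
Qed.

(** Each isotropic vector over K is traded for one over F, which lets [reduce] lower the dimension
    over F itself. *)
Lemma anisotropic_descent q : exists2 q', anis q'^K & descends q q'.
Proof.
have [d] := ubnP (qdim q); elim: d q => // d IH q dq.
have [an|] := pselect (anis q^K).
  by exists q => //; exact: descends_iso.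
move/existsNP => [v /not_implyP[qv /eqP v0]].
have [n [m [a [b [c H]]]]] := decomp charF q.
have Hq : iso q (nfq a b c) by rewrite nfq_iso.
have := iso_qext iota Hq; rewrite qext_nfq => -[f [g [fK gK fq]]].
have nz : f v != 0.
  by apply: contraNneq v0 => fv0; rewrite -(fK v) fv0 -(linear0 f) fK.
have := fq v; rewrite qv.
case: (f v) nz => [[x y] z] nz nf0.
have [||a' [b' [c' [R [v' v'0 qv']]]]] := @isotropic_descent n m a b c x y z.
- apply: contraNT nz; rewrite !negb_or !negbK => /and3P[/eqP-> /eqP-> /eqP->].
  by [].
- exact: nf0.
have [q' [k [l [dq' H']]]] := reduce charF v'0 qv'.
have [|q'' an Rq''] := IH q'.
  by apply: leq_trans dq' _; rewrite -ltnS; apply: leq_trans dq; rewrite (iso_dim Hq).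
exists q'' => //; apply: descends_trans Rq''.
apply: descends_trans (descends_iso Hq) (descends_trans R _).
apply: descends_weq; first by rewrite H' weq_Zf.
by move=> ns; have /nonsing_psum[] := nonsing_iso H' ns.
Qed.

End Kernel.

(** * From forms to Witt classes *)

Section WittClasses.
Variable F : fieldType.
Hypothesis char2 : 2 = 0 :> F.
Implicit Types q r : qform F.

Lemma mem_witt_class q r : witt_class q r <-> nonsing r /\ weq r q.
Proof.
by split=> -[ns H]; split=> //; apply/(witt_equivE char2).
Qed.

Lemma witt_class_id q : nonsing q -> witt_class q q.
Proof. by move=> ns; apply/mem_witt_class. Qed.

Lemma eq_witt_class q r : weq q r -> witt_class q = witt_class r.
Proof.
move=> H; apply/seteqP; split=> s /mem_witt_class[ns E]; apply/mem_witt_class;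
  by rewrite ?H // -H.
Qed.

Lemma witt_class_inj q r : nonsing q -> witt_class q = witt_class r -> weq q r.
Proof.
by move=> /witt_class_id qq E; rewrite E in qq; case/mem_witt_class: qq.
Qed.

(** A union over all representatives collapses to one term when the terms agree; this makes the
    operations on classes computable. *)
Lemma bigcup_witt_class (L : fieldType) q (f : qform F -> set (qform L)) :
  nonsing q -> (forall r, weq r q -> nonsing r -> f r = f q) ->
  (\bigcup_(r in witt_class q) f r)%classic = f q.
Proof.
move=> ns fE; apply/seteqP; split=> [s [r /mem_witt_class[nr rq]]|s fs].
  by rewrite (fE r).
by exists q => //; exact: witt_class_id.
Qed.

Lemma witt_add_class q r : nonsing q -> nonsing r ->
  witt_add (witt_class q) (witt_class r) = witt_class (perp q r).
Proof.
move=> nq nr; rewrite /witt_add bigcup_witt_class // => [|q' q'q _].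
  rewrite bigcup_witt_class // => r' r'r _; apply: eq_witt_class.
  by rewrite !perp_psum r'r.
rewrite !bigcup_witt_class // => [|r' r'r _|r' r'r _]; apply: eq_witt_class;
  by rewrite !perp_psum ?q'q ?r'r.
Qed.

Lemma witt_diag_class t q : t != 0 -> nonsing q ->
  witt_diag [:: 1; t] (witt_class q) = witt_class (diag_tensor [:: 1; t] q).
Proof.
move=> t0 nq; apply: bigcup_witt_class => // r rq _; apply: eq_witt_class.
by rewrite !diag_tensor_iso; apply: weq_psum => //; exact: sc_weq.
Qed.

End WittClasses.

Lemma witt_ext_class (F K : fieldType) (iota : {rmorphism F -> K})
    (q : qform F) : 2 = 0 :> F -> nonsing q ->
  witt_ext iota (witt_class q) = witt_class (qext iota q).
Proof.
move=> char2 nq; apply: bigcup_witt_class => // r rq _.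
by apply: (eq_witt_class (char2K iota char2)); exact: weq_qext.
Qed.

Section KernelGenerators.
Variables (F K : fieldType) (iota : {rmorphism F -> K}).
Hypothesis char2 : 2 = 0 :> F.
Local Notation square := (nonzero_squares iota).
Local Notation kernel_sum :=
  (subgroup_sum square (fun t : F => diag_Wq [:: 1; t])).

Lemma kernel_gen_kernel_sum S : kernel_gen iota S -> kernel_sum (witt_class S).
Proof.
elim=> [|t r S1 sqt nr gS1 [n [u [D [uD E]]]]].
  exists 0%N, (fun => 0), (fun => @witt0 F); split=> [[]//|].
  by rewrite big_ord0.
(* Index 0 carries the new generator; [unlift] recovers the old indices. *)
exists n.+1, (fun i => oapp u t (unlift ord0 i)),
  (fun i => oapp D (witt_class (diag_tensor [:: 1; t] r)) (unlift ord0 i)).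
split=> [i|]; last first.
  rewrite big_ord_recl unlift_none /=.
  under eq_bigr => i _ do rewrite liftK /=.
  rewrite -E witt_add_class //; first exact: (nonsing_diag sqt).
  exact: kernel_gen_nonsing gS1.
case: unliftP => [j _|_] /=; first exact: uD.
split=> //; exists (witt_class r); first by exists r.
by apply: witt_diag_class => //; exact: square_neq0 sqt.
Qed.

Lemma kernel_sum_gen C : kernel_sum C ->
  exists2 S, kernel_gen iota S & C = witt_class S.
Proof.
move=> [n [t [D [tD ->]]]].
apply: (big_ind (fun C => exists2 S, kernel_gen iota S & C = witt_class S)).
- by exists (qzero F 0); first exact: kernel_gen0.
- move=> C1 C2 [S1 g1 ->] [S2 g2 ->].
  have [S g E] := kernel_gen_perp g1 g2; exists S => //.
  have [n1 n2] := (kernel_gen_nonsing g1, kernel_gen_nonsing g2).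
  rewrite witt_add_class //; apply: eq_witt_class => //.
  by rewrite perp_psum E.
- move=> i _; have [sqt [_ [r nr <-] <-]] := tD i.
  exists (perp (diag_tensor [:: 1; t i] r) (qzero F 0)).
    by apply: kernel_genS => //; exact: kernel_gen0.
  have t0 := square_neq0 sqt; rewrite witt_diag_class //.
  apply: eq_witt_class => //; rewrite perp_psum psum_null // => x; exact: rV0.
Qed.

End KernelGenerators.

Theorem mainTheorem1 (F K : fieldType) (iota : {rmorphism F -> K})
    (charF : 2%N \in [pchar F])
    (K2F : forall x : K, exists a : F, iota a = x ^+ 2) :
  excellent iota /\
  Wq_kernel iota =
    subgroup_sum (nonzero_squares iota) (fun t : F => diag_Wq [:: 1; t]).
Proof.
have char2 : 2 = 0 :> F := pcharf0 charF.
have char2_K := char2K iota char2.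
split=> [q|].
  have [q' an [qq' _]] := anisotropic_descent char2 K2F q.
  have [p [k [m [anp E]]]] := anis_part_exists char2_K (qext iota q).
  (* [p] and the extension of q' are anisotropic and Witt equivalent over K, hence isometric. *)
  exists q', p; split; first by apply/anisotropic_partE; split=> //; exists k, m.
  apply/isometricE; apply: anis_weq_iso => //.
  by rewrite -qq' E weq_Zf.
apply/seteqP; split=> C.
  move=> [[q nq <-]]; rewrite witt_ext_class // => /esym E.
  have Eq : weq (qext iota q) (qzero K 0).
    symmetry; apply: (witt_class_inj char2_K) E; exact: nonsing_qzero.
  have [q' an [qq' /(_ nq)[_ [S gS HS]]]] := anisotropic_descent char2 K2F q.
  (* An anisotropic form in the trivial class has dimension 0, and extension preserves dimension; so
     q' is null and [q] is Witt equivalent to [S]. *)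
  have : iso (qext iota q') (qzero K 0).
    apply: anis_weq_iso => //; first by move=> x _; exact: rV0.
    by rewrite -qq'.
  move=> /iso_dim /= dq'.
  rewrite (@eq_witt_class _ char2 _ S); first exact: kernel_gen_kernel_sum.
  rewrite HS psumC psum_null // /= dq' => x; exact: rV0.
move=> /(kernel_sum_gen char2)[S gS ->]; have nS := kernel_gen_nonsing gS.
split; first by exists S.
rewrite witt_ext_class //; apply: eq_witt_class => //.
by rewrite (kernel_gen_qext char2 gS) qzero_Zf.
Qed.
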